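(* Let $S$ be a subsemigroup of $(M_n(\mathbb{C}),+)$ and assume that $M \mapsto \exp(M)$ is a homomorphism from $(S,+)$ to $(\mathrm{GL}_n(\mathbb{C}),\times)$, i.e. $\exp(A+B)=\exp(A)\exp(B)$ for all $A,B\in S$. Then the linear span $\mathrm{Span}(S)$ of $S$ in $M_n(\mathbb{C})$ has property L.
   Context: A linear subspace $V$ of $M_n(\mathbb{C})$ has property L if there exist $n$ linear forms $f_1,\dots,f_n$ on $V$ such that for every $M \in V$, the characteristic polynomial of $M$ equals $\prod_{k=1}^n (X - f_k(M))$ (i.e. the eigenvalues of $M$ counted with algebraic multiplicity are $f_1(M),\dots,f_n(M)$). *)

(* Defs.v *)
From Stdlib Require Import Reals ClassicalEpsilon FunctionalExtensionality.
From HB Require Import structures.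
From mathcomp Require Import all_boot all_order all_algebra.
Set Implicit Arguments. Unset Strict Implicit. Unset Printing Implicit Defensive.

Record complex : Type := Cplx { Re : R; Im : R }.

Definition complex_eqb (x y : complex) : bool :=
  if excluded_middle_informative (x = y) then true else false.

Lemma complex_eqP : Equality.axiom complex_eqb.
Proof.
move=> x y; rewrite /complex_eqb.
by case: excluded_middle_informative => h; constructor.
Qed.

HB.instance Definition _ := hasDecEq.Build complex complex_eqP.

Definition complex_find (P : pred complex) (n : nat) : option complex :=
  match excluded_middle_informative (exists x, P x) with
  | left h => Some (proj1_sig (constructive_indefinite_description _ h))
  | right _ => None
  end.

Lemma complex_find_correct P n x : complex_find P n = Some x -> P x.
Proof.
rewrite /complex_find; case: excluded_middle_informative => // h [<-].
exact: proj2_sig (constructive_indefinite_description _ h).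
Qed.

Lemma complex_find_complete (P : pred complex) :
  (exists x, P x) -> exists n, complex_find P n.
Proof.
move=> h; exists 0%N; rewrite /complex_find.
by case: excluded_middle_informative.
Qed.

Lemma complex_find_ext (P Q : pred complex) :
  P =1 Q -> complex_find P =1 complex_find Q.
Proof.
by move=> hPQ n; have -> : P = Q by apply: functional_extensionality.
Qed.

HB.instance Definition _ := hasChoice.Build complex
  complex_find_correct complex_find_complete complex_find_ext.

Definition C0 : complex := Cplx R0 R0.
Definition C1 : complex := Cplx R1 R0.
Definition Cadd (x y : complex) : complex :=
  Cplx (Rplus (Re x) (Re y)) (Rplus (Im x) (Im y)).
Definition Copp (x : complex) : complex := Cplx (Ropp (Re x)) (Ropp (Im x)).
Definition Cmul (x y : complex) : complex :=
  Cplx (Rminus (Rmult (Re x) (Re y)) (Rmult (Im x) (Im y)))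
       (Rplus (Rmult (Re x) (Im y)) (Rmult (Im x) (Re y))).
Definition Cinv (x : complex) : complex :=
  let d := Rplus (Rmult (Re x) (Re x)) (Rmult (Im x) (Im x)) in
  Cplx (Rdiv (Re x) d) (Ropp (Rdiv (Im x) d)).

Lemma complex_ext (x y : complex) : Re x = Re y -> Im x = Im y -> x = y.
Proof. by case: x => a b; case: y => c d /= -> ->. Qed.

Lemma CaddA : associative Cadd.
Proof. move=> x y z; apply: complex_ext => /=; ring. Qed.
Lemma CaddC : commutative Cadd.
Proof. move=> x y; apply: complex_ext => /=; ring. Qed.
Lemma Cadd0 : left_id C0 Cadd.
Proof. move=> x; apply: complex_ext => /=; ring. Qed.
Lemma CaddN : left_inverse C0 Copp Cadd.
Proof. move=> x; apply: complex_ext => /=; ring. Qed.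

HB.instance Definition _ :=
  GRing.isZmodule.Build complex CaddA CaddC Cadd0 CaddN.

Lemma CmulA : associative Cmul.
Proof. move=> x y z; apply: complex_ext => /=; ring. Qed.
Lemma CmulC : commutative Cmul.
Proof. move=> x y; apply: complex_ext => /=; ring. Qed.
Lemma Cmul1 : left_id C1 Cmul.
Proof. move=> x; apply: complex_ext => /=; ring. Qed.
Lemma CmulDl : left_distributive Cmul Cadd.
Proof. move=> x y z; apply: complex_ext => /=; ring. Qed.
Lemma C1_neq0 : C1 != C0.
Proof.
apply/eqP => h; have : Re C1 = Re C0 by rewrite h.
by apply: R1_neq_R0.
Qed.

HB.instance Definition _ :=
  GRing.Zmodule_isComNzRing.Build complex CmulA CmulC Cmul1 CmulDl C1_neq0.

Lemma CmulV (x : complex) : x != 0%R -> Cmul (Cinv x) x = C1.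
Proof.
case: x => a b /eqP hx.
have hd : Rplus (Rmult a a) (Rmult b b) <> R0.
  move=> hd; apply: hx.
  have ha : a = R0 by apply: Rplus_sqr_eq_0_l hd.
  have hb : b = R0.
    by apply: (Rplus_sqr_eq_0_l b a); rewrite Rplus_comm.
  by rewrite ha hb.
apply: complex_ext => /=; field; exact: hd.
Qed.

Lemma Cinv0 : Cinv 0%R = 0%R.
Proof. apply: complex_ext => /=; rewrite /Rdiv; ring. Qed.

HB.instance Definition _ := GRing.ComNzRing_isField.Build complex CmulV Cinv0.

Local Open Scope ring_scope.

Fixpoint mxpow (n : nat) (M : 'M[complex]_n) (k : nat) : 'M[complex]_n :=
  match k with
  | O => 1%:M
  | S k => M *m mxpow M k
  end.

Definition exp_partial (n : nat) (M : 'M[complex]_n) (N : nat) : 'M[complex]_n :=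
  \sum_(k < N) ((k`!)%:R)^-1 *: mxpow M k.

Definition mx_cv (n : nat) (u : nat -> 'M[complex]_n) (L : 'M[complex]_n) : Prop :=
  forall i j : 'I_n,
    Un_cv (fun N => Re (u N i j)) (Re (L i j)) /\
    Un_cv (fun N => Im (u N i j)) (Im (L i j)).

(* exp M := the limit of the exponential series (which always exists and is
   unique; chosen by Hilbert's epsilon) *)
Definition mexp (n : nat) (M : 'M[complex]_n) : 'M[complex]_n :=
  epsilon (inhabits (0 : 'M[complex]_n)) (fun E => mx_cv (exp_partial M) E).

Definition in_span (n : nat) (S : 'M[complex]_n -> Prop) (M : 'M[complex]_n) : Prop :=
  exists (k : nat) (c : 'I_k -> complex) (A : 'I_k -> 'M[complex]_n),
    (forall i, S (A i)) /\ M = \sum_(i < k) c i *: A i.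

Definition linear_form_on (n : nat) (V : 'M[complex]_n -> Prop)
  (f : 'M[complex]_n -> complex) : Prop :=
  forall (a : complex) (A B : 'M[complex]_n), V A -> V B ->
    f (a *: A + B) = a * f A + f B.

Definition property_L (n : nat) (V : 'M[complex]_n -> Prop) : Prop :=
  exists f : 'I_n -> 'M[complex]_n -> complex,
    (forall k, linear_form_on V (f k)) /\
    (forall M, V M -> char_poly M = \prod_(k < n) ('X - (f k M)%:P)).

(* Main.v *)
(**
The exponentials [exp A], [A] in [S], commute, and every eigenvector of [A] for
[l] is one of [exp A] for [exp l]. By induction on the size of the matrices we
find matrices [H_1, ..., H_n] such that every [A] in [S] has the eigenvalues
[tr (H_k A)].

If some [exp A] has two eigenvalues whose ratio is not a root of unity, split
the space into two sums of generalized eigenspaces of [exp A], two eigenvalues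
belonging to the same part as soon as their ratio is a root of unity. For [B]
in [S] and large [k] the blocks of [exp A ^ k exp B] have no common eigenvalue,
so that [k A + B], which commutes with it, is block diagonal; hence so are all
elements of [S], and the induction hypothesis applies to the blocks.

Otherwise, for [A, B] in [S] there are [N] and scalars [a, b] such that, with
[X = N (A - a) / (2 i pi)] and [Y = N (B - b) / (2 i pi)], all the matrices
[u X + v Y], [u, v] natural numbers not both zero, have integral eigenvalues.
A bound on the distance from the eigenvalues of [k (X + Y) + Y] to the [k a_i],
[a_i] the eigenvalues of [X + Y], leaves finitely many possible shapes for these
spectra, and one of them is valid for all [k]; so the pencil of [A] and [B]
splits into linear factors. When [A] has as many distinct eigenvalues as
possible, the linear factors are given by traces against polynomials in [A],
hence are linear in [B].

As polynomial identities in the coefficients, the factorizations pass from [S]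
to its span.
*)

From Stdlib Require Import ZArith Reals Lra Factorial Classical.
From Stdlib Require Import ClassicalEpsilon.
From Coquelicot Require Import Rbar Hierarchy Lim_seq Series PSeries Derive.
From Coquelicot Require Import ElemFct AutoDerive.

(** * Real power series for the exponential of a complex number *)

Section ExpSeries.
Local Open Scope R_scope.

(** The sums in [S] stop just before index [N] while [sum_n t N] includes it; a shift by one leaves
    the limit unchanged. *)
Lemma Un_cv_series (S t : nat -> R) l :
  S O = 0 -> (forall N, S (Datatypes.S N) = S N + t N) -> is_series t l ->
  Un_cv S l.
Proof.
intros S0 St Hl.
apply is_lim_seq_Reals, is_lim_seq_incr_1.
apply is_lim_seq_ext with (sum_n t); [|exact Hl].
intros N; induction N as [|N IH].
- rewrite sum_O, St, S0; ring.
- rewrite sum_Sn, IH, (St (Datatypes.S N)); reflexivity.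
Qed.

Lemma ex_series_exp_bound (u : nat -> R) B :
  (forall k, Rabs (u k) <= B ^ k) -> ex_series (fun k => u k / INR (fact k)).
Proof.
intros Hu.
apply @ex_series_le with (b := fun k => B ^ k / INR (fact k)).
- intros k; change (Rabs (u k / INR (fact k)) <= B ^ k / INR (fact k)).
  assert (Hf := INR_fact_lt_0 k).
  unfold Rdiv; rewrite Rabs_mult, (Rabs_pos_eq (/ INR (fact k))).
  + apply Rmult_le_compat_r; [left; now apply Rinv_0_lt_compat|apply Hu].
  + left; now apply Rinv_0_lt_compat.
- exists (exp B).
  apply is_series_ext with (fun k => scal (pow_n B k) (/ INR (fact k))).
  + intros k; rewrite pow_n_pow; reflexivity.
  + apply is_exp_Reals.
Qed.

(** Real and imaginary parts of [(a + i b)^k], kept as a pair of reals so that real power series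
    apply. *)
Fixpoint cpow (a b : R) (k : nat) : R * R :=
  match k with
  | O => (1, 0)
  | Datatypes.S k => let (x, y) := cpow a b k in (a * x - b * y, a * y + b * x)
  end.

Lemma cpow_bound a b k :
  Rabs (fst (cpow a b k)) + Rabs (snd (cpow a b k)) <= (Rabs a + Rabs b) ^ k.
Proof.
induction k as [|k IH]; simpl.
- rewrite Rabs_R1, Rabs_R0; lra.
- destruct (cpow a b k) as [x y]; simpl in *.
  assert (Ha := Rabs_pos a); assert (Hb := Rabs_pos b).
  apply Rle_trans with ((Rabs a + Rabs b) * (Rabs x + Rabs y)).
  + assert (H1 := Rabs_triang (a * x) (- (b * y))).
    assert (H2 := Rabs_triang (a * y) (b * x)).
    rewrite Rabs_Ropp in H1; rewrite !Rabs_mult in *; unfold Rminus; lra.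
  + apply Rmult_le_compat_l; lra.
Qed.

(** For every real [r] the terms [u k * r ^ k / k!] tend to 0, hence are bounded, so the radius is
    at least [r]. *)
Lemma CV_radius_exp_bound (u : nat -> R) B :
  (forall k, Rabs (u k) <= B ^ k) ->
  CV_radius (fun k => u k / INR (fact k)) = p_infty.
Proof.
intros Hu.
destruct (CV_radius_bounded (fun k => u k / INR (fact k))) as [ub _].
assert (H : forall r : R, Rbar_le (Finite r)
    (CV_radius (fun k => u k / INR (fact k)))).
{ intros r; apply ub.
  destruct (filterlim_bounded (fun k => u k * r ^ k / INR (fact k)))
    as [M HM].
  - exists 0; apply (ex_series_lim_0 (fun k => u k * r ^ k / INR (fact k))).
    apply ex_series_exp_bound with (B * Rabs r); intros k.
    rewrite Rabs_mult, Rpow_mult_distr, RPow_abs.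
    apply Rmult_le_compat_r; [apply Rabs_pos|apply Hu].
  - exists M; intros k.
    replace (u k / INR (fact k) * r ^ k) with (u k * r ^ k / INR (fact k)).
    + apply HM.
    + field; apply INR_fact_neq_0. }
destruct (CV_radius _) as [r| |].
- specialize (H (r + 1)); simpl in H; lra.
- reflexivity.
- destruct (H 0).
Qed.

Section ExpCpow.
Variables a b : R.

Let u k := fst (cpow a b k) / INR (fact k).
Let v k := snd (cpow a b k) / INR (fact k).

Lemma CV_radius_fst_cpow : CV_radius u = p_infty.
Proof.
apply CV_radius_exp_bound with (Rabs a + Rabs b); intros k.
assert (H := cpow_bound a b k); assert (H' := Rabs_pos (snd (cpow a b k))); lra.
Qed.

Lemma CV_radius_snd_cpow : CV_radius v = p_infty.
Proof.
apply CV_radius_exp_bound with (Rabs a + Rabs b); intros k.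
assert (H := cpow_bound a b k); assert (H' := Rabs_pos (fst (cpow a b k))); lra.
Qed.

(** Termwise differentiation multiplies the series of the [(a + i b)^k t^k / k!] by [a + i b]; the
    two claims are its real and imaginary parts. *)
Lemma PSeries_derive_cpow (t : R) :
  is_derive (PSeries u) t (a * PSeries u t - b * PSeries v t) /\
  is_derive (PSeries v) t (a * PSeries v t + b * PSeries u t).
Proof.
assert (Hfact : forall k, INR (fact (S k)) = INR (S k) * INR (fact k))
  by (intros k; rewrite <- mult_INR; reflexivity).
assert (Eu : ex_pseries u t)
  by (apply CV_radius_inside; rewrite CV_radius_fst_cpow; exact I).
assert (Ev : ex_pseries v t)
  by (apply CV_radius_inside; rewrite CV_radius_snd_cpow; exact I).
assert (Es : forall (c : R) (w : nat -> R),
    ex_pseries w t -> ex_pseries (PS_scal c w) t)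
  by (intros; apply ex_pseries_scal; [apply Rmult_comm|assumption]).
split.
- replace (a * PSeries u t - b * PSeries v t) with (PSeries (PS_derive u) t).
  + apply is_derive_PSeries; rewrite CV_radius_fst_cpow; exact I.
  + rewrite (PSeries_ext _ (PS_plus (PS_scal a u) (PS_scal (- b) v))).
    * rewrite PSeries_plus, !PSeries_scal by auto; ring.
    * intros k; unfold PS_derive, PS_plus, PS_scal, u, v.
      rewrite Hfact; simpl cpow; destruct (cpow a b k) as [x y].
      simpl fst; simpl snd.
      unfold plus, scal; simpl; unfold mult; simpl.
      change (match k with O => 1 | Datatypes.S _ => INR k + 1 end)
        with (INR (S k)).
      field; split; [apply INR_fact_neq_0|apply not_0_INR; discriminate].
- replace (a * PSeries v t + b * PSeries u t) with (PSeries (PS_derive v) t).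
  + apply is_derive_PSeries; rewrite CV_radius_snd_cpow; exact I.
  + rewrite (PSeries_ext _ (PS_plus (PS_scal a v) (PS_scal b u))).
    * rewrite PSeries_plus, !PSeries_scal by auto; ring.
    * intros k; unfold PS_derive, PS_plus, PS_scal, u, v.
      rewrite Hfact; simpl cpow; destruct (cpow a b k) as [x y].
      simpl fst; simpl snd.
      unfold plus, scal; simpl; unfold mult; simpl.
      change (match k with O => 1 | Datatypes.S _ => INR k + 1 end)
        with (INR (S k)).
      field; split; [apply INR_fact_neq_0|apply not_0_INR; discriminate].
Qed.

(* With [F = sum u_k t^k] and [G = sum v_k t^k], the product of [F + i G] with
   [exp (- (a + i b) t)] has derivative [0]. *)
Lemma PSeries_cpow :
  PSeries u 1 = exp a * cos b /\ PSeries v 1 = exp a * sin b.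
Proof.
(* [p] and [q] are the real and imaginary parts of this product; being constant, they keep at 1
   their values 1 and 0 at 0. *)
pose (p := fun t => exp (- (a * t)) *
  (PSeries u t * cos (b * t) + PSeries v t * sin (b * t))).
pose (q := fun t => exp (- (a * t)) *
  (PSeries v t * cos (b * t) - PSeries u t * sin (b * t))).
assert (dp : forall t, 0 <= t <= 1 -> is_derive p t 0).
{ intros t _; destruct (PSeries_derive_cpow t) as [du dv]; unfold p.
  auto_derive.
  - repeat split; eexists; eassumption.
  - assert (eu := is_derive_unique _ _ _ du).
    assert (ev := is_derive_unique _ _ _ dv).
    change (Derive (fun x => PSeries u x) t) with (Derive (PSeries u) t).
    change (Derive (fun x => PSeries v x) t) with (Derive (PSeries v) t).
    rewrite eu, ev; ring. }
assert (dq : forall t, 0 <= t <= 1 -> is_derive q t 0).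
{ intros t _; destruct (PSeries_derive_cpow t) as [du dv]; unfold q.
  auto_derive.
  - repeat split; eexists; eassumption.
  - assert (eu := is_derive_unique _ _ _ du).
    assert (ev := is_derive_unique _ _ _ dv).
    change (Derive (fun x => PSeries u x) t) with (Derive (PSeries u) t).
    change (Derive (fun x => PSeries v x) t) with (Derive (PSeries v) t).
    rewrite eu, ev; ring. }
assert (p01 := eq_is_derive p 0 1 dp Rlt_0_1).
assert (q01 := eq_is_derive q 0 1 dq Rlt_0_1).
unfold p, q in p01, q01.
rewrite !PSeries_0, !Rmult_0_r, !Rmult_1_r, Ropp_0 in p01, q01.
rewrite exp_0, cos_0, sin_0 in p01, q01.
unfold u at 1, v at 1 in p01; unfold v at 1, u at 1 in q01; simpl in p01, q01.
rewrite exp_Ropp in p01, q01.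
set (x := PSeries u 1) in *; set (y := PSeries v 1) in *.
assert (Ea := exp_pos a).
assert (p1 : x * cos b + y * sin b = exp a).
{ apply Rmult_eq_reg_l with (/ exp a); [|apply Rinv_neq_0_compat; lra].
  rewrite <- p01; field; lra. }
assert (q1 : y * cos b - x * sin b = 0).
{ apply Rmult_eq_reg_l with (/ exp a); [|apply Rinv_neq_0_compat; lra].
  rewrite <- q01; field; lra. }
assert (cs := sin2_cos2 b); unfold Rsqr in cs.
split.
- replace x with (x * (sin b * sin b + cos b * cos b)) by (rewrite cs; ring).
  rewrite <- p1; replace (x * (sin b * sin b + cos b * cos b))
    with ((x * cos b + y * sin b) * cos b - (y * cos b - x * sin b) * sin b)
    by ring.
  rewrite q1; ring.
- replace y with (y * (sin b * sin b + cos b * cos b)) by (rewrite cs; ring).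
  rewrite <- p1; replace (y * (sin b * sin b + cos b * cos b))
    with ((x * cos b + y * sin b) * sin b + (y * cos b - x * sin b) * cos b)
    by ring.
  rewrite q1; ring.
Qed.

Lemma is_series_cpow :
  is_series u (exp a * cos b) /\ is_series v (exp a * sin b).
Proof.
destruct PSeries_cpow as [Hu Hv]; rewrite <- Hu, <- Hv, !PSeries_1.
split; apply Series_correct;
  apply ex_series_exp_bound with (Rabs a + Rabs b); intros k;
  assert (H := cpow_bound a b k).
- assert (H' := Rabs_pos (snd (cpow a b k))); lra.
- assert (H' := Rabs_pos (fst (cpow a b k))); lra.
Qed.

End ExpCpow.

Lemma exp_cos_sin_eq1 a b :
  exp a * cos b = 1 -> exp a * sin b = 0 ->
  a = 0 /\ exists z : Z, b = IZR z * (2 * PI).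
Proof.
intros Hc Hs; assert (Ea := exp_pos a).
assert (s0 : sin b = 0) by nra.
assert (cs := sin2_cos2 b); unfold Rsqr in cs; rewrite s0 in cs.
assert (c1 : cos b = 1) by nra.
split.
- apply exp_inv; rewrite exp_0; rewrite c1 in Hc; lra.
(* Halving the angle yields multiples of [2 PI]; [sin b = 0] alone would only give multiples of
   [PI]. *)
- assert (sh : sin (b / 2) = 0).
  { assert (H := cos_2a_sin (b / 2)).
    replace (2 * (b / 2)) with b in H by field; nra. }
  destruct (sin_eq_0_0 _ sh) as [z Hz]; exists z; lra.
Qed.

End ExpSeries.

From mathcomp Require Import complex Rstruct.
From HB Require Import structures.
From mathcomp Require Import all_boot all_order all_algebra.
Require Import Defs.
Set Implicit Arguments.
Unset Strict Implicit.
Unset Printing Implicit Defensive.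
Import Order.TTheory GRing.Theory Num.Theory Defs.
Local Open Scope ring_scope.

(** * Convergence of the matrix exponential and its action on eigenvectors *)

Section MatrixExponential.

Definition ccv (u : nat -> complex) (l : complex) :=
  Un_cv (fun N => Re (u N)) (Re l) /\ Un_cv (fun N => Im (u N)) (Im l).

Lemma ccv_const c : ccv (fun=> c) c.
Proof.
by split=> e e_gt0; exists 0%N => N _; rewrite /Rdist Rminus_diag Rabs_R0.
Qed.

Lemma ccv_ext u u' l : u' =1 u -> ccv u l -> ccv u' l.
Proof.
move=> uu' [ul1 ul2]; split=> e e_gt0.
  by have [N HN] := ul1 e e_gt0; exists N => k kN; rewrite uu'; apply: HN.
by have [N HN] := ul2 e e_gt0; exists N => k kN; rewrite uu'; apply: HN.
Qed.

Lemma ccv_uniq u l l' : ccv u l -> ccv u l' -> l = l'.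
Proof.
move=> [u1 u2] [u1' u2'].
by apply: complex_ext; apply: UL_sequence; eassumption.
Qed.

Lemma ccvD u u' l l' :
  ccv u l -> ccv u' l' -> ccv (fun N => u N + u' N) (l + l').
Proof. by move=> [u1 u2] [u1' u2']; split; apply: CV_plus. Qed.

Lemma ccvM u u' l l' :
  ccv u l -> ccv u' l' -> ccv (fun N => u N * u' N) (l * l').
Proof.
move=> [u1 u2] [u1' u2']; split.
  by apply: CV_minus; apply: CV_mult.
by apply: CV_plus; apply: CV_mult.
Qed.

Lemma ccv_sum n (u : 'I_n -> nat -> complex) (l : 'I_n -> complex) :
  (forall i, ccv (u i) (l i)) ->
  ccv (fun N => \sum_i u i N) (\sum_i l i).
Proof.
move=> ul; elim: n u l ul => [|n IHn] u l ul.
  rewrite big_ord0; apply: ccv_ext (ccv_const 0) => N.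
  by rewrite big_ord0.
rewrite big_ord_recl.
have := ccvD (ul ord0) (IHn _ _ (fun i => ul (lift ord0 i))).
by apply: ccv_ext => N; rewrite big_ord_recl.
Qed.

Lemma ccv_mulmxl m n p (A : 'M[complex]_(m, n)) (u : nat -> 'M_(n, p))
    (L : 'M_(n, p)) :
  (forall i j, ccv (fun N => u N i j) (L i j)) ->
  forall i j, ccv (fun N => (A *m u N) i j) ((A *m L) i j).
Proof.
move=> uL i j; rewrite mxE.
have := ccv_sum (fun k => ccvM (ccv_const (A i k)) (uL k j)).
by apply: ccv_ext => N; rewrite mxE.
Qed.

Lemma ccv_mulmxr m n p (A : 'M[complex]_(n, p)) (u : nat -> 'M_(m, n))
    (L : 'M_(m, n)) :
  (forall i j, ccv (fun N => u N i j) (L i j)) ->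
  forall i j, ccv (fun N => (u N *m A) i j) ((L *m A) i j).
Proof.
move=> uL i j; rewrite mxE.
have := ccv_sum (fun k => ccvM (uL i k) (ccv_const (A k j))).
by apply: ccv_ext => N; rewrite mxE.
Qed.

Lemma natr_complex k : k%:R = Cplx (INR k) R0.
Proof.
elim: k => [|k IHk] //; rewrite mulrSr IHk S_INR.
by apply: complex_ext => //=; rewrite Rplus_0_r.
Qed.

(** Bridges the two factorials, so that complex partial sums can be read as real series, part by
    part. *)
Lemma inv_factr_mul k (z : complex) : (k`!)%:R^-1 * z =
  Cplx (Rdiv (Re z) (INR (fact k))) (Rdiv (Im z) (INR (fact k))).
Proof.
have -> : k`! = fact k by elim: k => // k IHk; rewrite factS IHk.
have nz := INR_fact_neq_0 k.
have nz' : (fact k)%:R != 0 :> complex.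
  by apply/eqP; rewrite natr_complex => -[].
apply: (mulfI nz'); rewrite mulrA divff // mul1r natr_complex.
by apply: complex_ext => /=; field.
Qed.

(** This norm is submultiplicative and avoids square roots. *)
Definition norm1 (z : complex) := Rplus (Rabs (Re z)) (Rabs (Im z)).
Local Open Scope R_scope.

Lemma norm1D x y : norm1 (x + y)%R <= norm1 x + norm1 y.
Proof.
rewrite /norm1 /=; have := Rabs_triang (Re x) (Re y).
have := Rabs_triang (Im x) (Im y); lra.
Qed.

Lemma norm1M x y : norm1 (x * y)%R <= norm1 x * norm1 y.
Proof.
rewrite /norm1 /= /Rminus.
have := Rabs_triang (Re x * Re y) (- (Im x * Im y)).
have := Rabs_triang (Re x * Im y) (Im x * Re y).
rewrite Rabs_Ropp !Rabs_mult; lra.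
Qed.

Lemma norm1_ge0 x : 0 <= norm1 x.
Proof.
rewrite /norm1; have := Rabs_pos (Re x); have := Rabs_pos (Im x); lra.
Qed.

Lemma norm1_sum n (f : 'I_n -> complex) c :
  (forall i, norm1 (f i) <= c) -> norm1 (\sum_i f i)%R <= INR n * c.
Proof.
elim: n f => [|n IHn] f fc.
  by rewrite big_ord0 /norm1 /= Rabs_R0; lra.
rewrite big_ord_recl S_INR; apply: Rle_trans (norm1D _ _) _.
have := IHn (fun i => f (lift ord0 i)) (fun i => fc _); have := fc ord0.
set x := norm1 _; set y := norm1 _; lra.
Qed.

Lemma ord_bounded n (f : 'I_n -> R) : exists b, forall i, f i <= b.
Proof.
elim: n f => [|n IHn] f; first by exists 0 => -[].
have [b fb] := IHn (fun i => f (lift ord0 i)).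
exists (Rmax b (f ord0)) => i; case: (unliftP ord0 i) => [j|] ->.
  exact: Rle_trans (fb j) (Rmax_l _ _).
exact: Rmax_r.
Qed.

(** If [b] bounds the entries of [M], each further product with [M] sums [n] terms, so [B = n b]
    works. *)
Lemma norm1_mxpow n (M : 'M[complex]_n) :
  exists B, forall k i j, norm1 (mxpow M k i j) <= B ^ k.
Proof.
have [b Mb] : exists b, forall i j, norm1 (M i j) <= b.
  pose row i := ClassicalEpsilon.constructive_indefinite_description _
    (ord_bounded (fun j => norm1 (M i j))).
  have [b Hb] := ord_bounded (fun i => proj1_sig (row i)).
  exists b => i j; apply: Rle_trans (Hb i); exact: proj2_sig (row i) j.
exists (INR n * b); elim=> [|k IHk] i j /=.
  have r0 : Rabs R0 = 0 := Rabs_R0; have r1 : Rabs R1 = 1 := Rabs_R1.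
  by rewrite mxE; case: (i == j); rewrite /norm1 /= ?r1 r0; lra.
rewrite mxE Rmult_assoc; apply: norm1_sum => l.
apply: Rle_trans (norm1M _ _) _.
apply: Rmult_le_compat => //; exact: norm1_ge0.
Qed.

Lemma ccv_exp_partial_exists n (M : 'M[complex]_n) i j :
  exists l, ccv (fun N => exp_partial M N i j) l.
Proof.
have [B MB] := norm1_mxpow M.
have [x Hx] : ex_series (fun k => Re (mxpow M k i j) / INR (fact k)).
  apply: (ex_series_exp_bound _ B) => k; apply: Rle_trans (MB k i j).
  by rewrite /norm1; have := Rabs_pos (Im (mxpow M k i j)); lra.
have [y Hy] : ex_series (fun k => Im (mxpow M k i j) / INR (fact k)).
  apply: (ex_series_exp_bound _ B) => k; apply: Rle_trans (MB k i j).
  by rewrite /norm1; have := Rabs_pos (Re (mxpow M k i j)); lra.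
exists (Cplx x y); split; [apply: Un_cv_series Hx|apply: Un_cv_series Hy].
- by rewrite /exp_partial big_ord0 mxE.
- by move=> N; rewrite /exp_partial big_ord_recr !mxE inv_factr_mul.
- by rewrite /exp_partial big_ord0 mxE.
- by move=> N; rewrite /exp_partial big_ord_recr !mxE inv_factr_mul.
Qed.

(** Hilbert's epsilon returns a limit as soon as one exists; one is assembled from the entrywise
    limits. *)
Lemma mexp_ccv n (M : 'M[complex]_n) i j :
  ccv (fun N => exp_partial M N i j) (mexp M i j).
Proof.
suff: exists E, mx_cv (exp_partial M) E.
  by move=> /(ClassicalEpsilon.epsilon_spec (inhabits 0%R))/(_ i j).
pose L i j := proj1_sig (ClassicalEpsilon.constructive_indefinite_description _
  (ccv_exp_partial_exists M i j)).
exists (\matrix_(i, j) L i j)%R => k l; rewrite mxE /L.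
by case: ClassicalEpsilon.constructive_indefinite_description.
Qed.

Local Close Scope R_scope.

(** [M] commutes with each partial sum, and limits are unique. *)
Lemma comm_mexp n (M : 'M[complex]_n) : mexp M *m M = M *m mexp M.
Proof.
have cpow k : mxpow M k *m M = M *m mxpow M k.
  by elim: k => [|k IHk] /=; rewrite ?mul1mx ?mulmx1 // -mulmxA IHk.
have cpart N : exp_partial M N *m M = M *m exp_partial M N.
  rewrite /exp_partial mulmx_suml mulmx_sumr; apply: eq_bigr => k _.
  by rewrite -scalemxAl -scalemxAr cpow.
apply/matrixP => i j; apply: (ccv_uniq (ccv_mulmxr M (mexp_ccv M) i j)).
by apply: ccv_ext (ccv_mulmxl M (mexp_ccv M) i j) => N; rewrite cpart.
Qed.

Definition cexp (z : complex) : complex :=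
  Cplx (Rmult (exp (Re z)) (cos (Im z))) (Rmult (exp (Re z)) (sin (Im z))).

Lemma cpowE (z : complex) k : cpow (Re z) (Im z) k = (Re (z ^+ k), Im (z ^+ k)).
Proof. by elim: k => [|k IHk] //; rewrite exprS /= IHk. Qed.

Lemma cexp_ccv z : ccv (fun N => \sum_(k < N) (k`!)%:R^-1 * z ^+ k) (cexp z).
Proof.
have [Hu Hv] := is_series_cpow (Re z) (Im z).
split; [apply: Un_cv_series Hu|apply: Un_cv_series Hv].
- by rewrite big_ord0.
- by move=> N; rewrite big_ord_recr inv_factr_mul cpowE.
- by rewrite big_ord0.
- by move=> N; rewrite big_ord_recr inv_factr_mul cpowE.
Qed.

(** On a left eigenvector the partial sums act as the scalar partial sums of [cexp l]. *)
Lemma mexp_eigenvector n (M : 'M[complex]_n) (v : 'rV_n) l :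
  v *m M = l *: v -> v *m mexp M = cexp l *: v.
Proof.
move=> vM; have vpow k : v *m mxpow M k = l ^+ k *: v.
  elim: k => [|k IHk] /=; first by rewrite mulmx1 scale1r.
  by rewrite mulmxA vM -scalemxAl IHk scalerA exprS.
apply/matrixP => i j; apply: (ccv_uniq (ccv_mulmxl v (mexp_ccv M) i j)).
rewrite mxE; apply: ccv_ext (ccvM (cexp_ccv l) (ccv_const (v i j))) => N.
rewrite /exp_partial mulmx_sumr summxE mulr_suml; apply: eq_bigr => k _.
by rewrite -scalemxAr vpow !mxE mulrA.
Qed.

Lemma cexpD x y : cexp (x + y) = cexp x * cexp y.
Proof.
by apply: complex_ext => /=; rewrite exp_plus ?cos_plus ?sin_plus; ring.
Qed.

Lemma cexp_neq0 x : cexp x != 0.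
Proof.
apply/eqP => -[]; have := exp_pos (Re x); have := sin2_cos2 (Im x).
rewrite /Rsqr => sc e_gt0 /Rmult_integral[|c0]; first by lra.
by move=> /Rmult_integral[|s0]; [lra|rewrite c0 s0 in sc; lra].
Qed.

Lemma int_of_Z (z : Z) : exists m : int, Cplx (IZR z) R0 = m%:~R.
Proof.
case: z => [|p|p].
- by exists 0.
- exists (Posz (Pos.to_nat p)); rewrite -pmulrn natr_complex.
  by rewrite INR_IZR_INZ positive_nat_Z.
exists (- Posz (Pos.to_nat p)); rewrite mulrNz -pmulrn natr_complex.
rewrite INR_IZR_INZ positive_nat_Z; apply: complex_ext => //=.
by rewrite Ropp_0.
Qed.

Definition two_pi_i : complex := Cplx R0 (Rmult (IZR 2) PI).

Lemma cexp_eq1 x : cexp x = 1 -> exists m : int, x = m%:~R * two_pi_i.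
Proof.
move=> [] /exp_cos_sin_eq1 /[apply] -[x0 [z xz]].
have [m zm] := int_of_Z z; exists m; rewrite -zm.
by apply: complex_ext; rewrite ?x0 ?xz /=; ring.
Qed.

Lemma two_pi_i_neq0 : two_pi_i != 0.
Proof. by apply/eqP => -[]; have := PI_RGT_0; lra. Qed.

End MatrixExponential.

From mathcomp Require Import ring zify.

(** * Spectra with multiplicity, and pencils of matrices *)

Section Spectrum.
Variable C : numClosedFieldType.

(** The order of [s] is immaterial; repetitions record algebraic multiplicity. *)
Definition has_spectrum n (M : 'M[C]_n) (s : seq C) :=
  char_poly M = \prod_(x <- s) ('X - x%:P).

Lemma has_spectrum_exists n (M : 'M[C]_n) : {s | has_spectrum M s}.
Proof.
have [s] := closed_field_poly_normal (char_poly M).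
by rewrite (monicP (char_poly_monic M)) scale1r => defM; exists s.
Qed.

Lemma has_spectrum_perm n (M : 'M[C]_n) s t :
  has_spectrum M s -> perm_eq s t -> has_spectrum M t.
Proof. by move=> Ms st; rewrite /has_spectrum Ms; apply: perm_big. Qed.

Lemma has_spectrum_uniq n (M : 'M[C]_n) s t :
  has_spectrum M s -> has_spectrum M t -> perm_eq s t.
Proof. by move=> Ms Mt; apply: prod_XsubC_eq; rewrite -Ms -Mt. Qed.

Lemma eigenvalue_spectrum n (M : 'M[C]_n) s a :
  has_spectrum M s -> eigenvalue M a = (a \in s).
Proof. by move=> Ms; rewrite eigenvalue_root_char Ms root_prod_XsubC. Qed.

Lemma size_spectrum n (M : 'M[C]_n) s : has_spectrum M s -> size s = n.
Proof.
move=> Ms; have := size_char_poly M.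
by rewrite Ms size_prod_XsubC => -[].
Qed.

Lemma mulmx1_dim m n (P : 'M[C]_(m, n)) (Q : 'M_(n, m)) :
  P *m Q = 1%:M -> Q *m P = 1%:M -> m = n.
Proof.
have le k l (U : 'M[C]_(k, l)) (V : 'M_(l, k)) : U *m V = 1%:M -> (k <= l)%N.
  move=> UV; rewrite -(mxrank1 C k) -UV (leq_trans (mxrankS (submxMl _ _))) //.
  exact: rank_leq_row.
by move=> PQ QP; apply/eqP; rewrite eqn_leq (le _ _ _ _ PQ) (le _ _ _ _ QP).
Qed.

(** Rectangular shapes are allowed for [P] and [Q] so that [m] may be a sum of two block sizes that
    is only provably equal to [n]. *)
Lemma char_poly_similar m n (P : 'M[C]_(m, n)) (Q : 'M_(n, m)) (A : 'M_n) :
  P *m Q = 1%:M -> Q *m P = 1%:M -> char_poly (P *m A *m Q) = char_poly A.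
Proof.
move=> PQ QP; have emn := mulmx1_dim PQ QP.
case: n / emn in P Q A PQ QP *.
rewrite /char_poly /char_poly_mx.
pose f (B : 'M[C]_m) := map_mx (@polyC C) B.
have fPQ : f P *m f Q = 1%:M by rewrite -map_mxM PQ map_mx1.
have -> : 'X%:M - f (P *m A *m Q) = f P *m ('X%:M - f A) *m f Q.
  rewrite mulmxBr mulmxBl /f !map_mxM /= -/f; congr (_ - _).
  by rewrite scalar_mxC -mulmxA fPQ mulmx1.
by rewrite !det_mulmx mulrAC -det_mulmx fPQ det1 mul1r.
Qed.

Lemma trig_mulmx_diag n (A B : 'M[C]_n) i :
  is_trig_mx A -> is_trig_mx B -> (A *m B) i i = A i i * B i i.
Proof.
move=> /is_trig_mxP tA /is_trig_mxP tB.
rewrite mxE (bigD1 i) //= big1 ?addr0 // => j ne_ji.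
case: (ltngtP j i) => [lt_ji|lt_ij|/val_inj eq_ji].
- by rewrite (tB j i) ?mulr0.
- by rewrite (tA i j) ?mul0r.
- by rewrite eq_ji eqxx in ne_ji.
Qed.

Lemma trig_mulmx n (A B : 'M[C]_n) :
  is_trig_mx A -> is_trig_mx B -> is_trig_mx (A *m B).
Proof.
move=> /is_trig_mxP tA /is_trig_mxP tB; apply/is_trig_mxP => i j lt_ij.
rewrite mxE big1 // => k _; case: (ltnP i k) => [lt_ik|le_ki].
  by rewrite tA ?mul0r.
by rewrite tB ?mulr0 // (leq_ltn_trans le_ki).
Qed.

Lemma horner_mx_trig n (T : 'M[C]_n.+1) p : is_trig_mx T ->
  is_trig_mx (horner_mx T p) /\ forall i, horner_mx T p i i = p.[T i i].
Proof.
move=> tT; elim/poly_ind: p => [|p c [tp dp]].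
  by rewrite rmorph0; split=> [|i]; rewrite ?mx0_is_trig // mxE horner0.
rewrite rmorphD rmorphM /= horner_mx_X horner_mx_C; split=> [|i].
  have /is_trig_mxP tpT := trig_mulmx tp tT.
  have /is_trig_mxP tc := scalar_mx_is_trig n.+1 c.
  by apply/is_trig_mxP => i j lt_ij; rewrite mxE tc // -mulmxE tpT // addr0.
by rewrite mxE -mulmxE trig_mulmx_diag // dp !hornerE mxE eqxx mulr1n.
Qed.

Lemma has_spectrum_trig n (M : 'M[C]_n) s : has_spectrum M s ->
  exists P T : 'M[C]_n, [/\ P \in unitmx, M = invmx P *m T *m P,
    is_trig_mx T & perm_eq s [seq T i i | i <- enum 'I_n]].
Proof.
move=> Ms; have [P PU] := @cotrigonalization _ n [:: M] (fun A B => ltac:(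
  rewrite !inE => /eqP -> /eqP ->; exact: comm_mx_refl)).
rewrite /= andbT /similar_to => tT.
have Pu := unitarymx_unit PU.
pose T := P *m M *m invmx P.
have eT : conjmx P M = T by rewrite conjumx.
exists P, T; split=> //.
- by rewrite /T !mulmxA mulVmx // mul1mx -mulmxA mulVmx // mulmx1.
- by rewrite -eT.
apply: (has_spectrum_uniq Ms); rewrite /has_spectrum big_map big_enum /=.
rewrite -char_poly_trig -?eT // eT char_poly_similar ?mulmxV ?mulVmx //.
Qed.

Lemma has_spectrum_trigonal n (P T : 'M[C]_n) :
  P \in unitmx -> is_trig_mx T ->
  has_spectrum (invmx P *m T *m P) [seq T i i | i <- enum 'I_n].
Proof.
move=> Pu tT; rewrite /has_spectrum big_map big_enum /= -char_poly_trig //.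
by rewrite char_poly_similar ?mulmxV ?mulVmx.
Qed.

Lemma has_spectrum_affine n (M : 'M[C]_n) s c d : has_spectrum M s ->
  has_spectrum (c *: M + d%:M) [seq c * x + d | x <- s].
Proof.
move=> /has_spectrum_trig[P [T [Pu -> tT sT]]].
have -> : c *: (invmx P *m T *m P) + d%:M = invmx P *m (c *: T + d%:M) *m P.
  rewrite mulmxDr mulmxDl -scalemxAr -scalemxAl; congr (_ + _).
  by rewrite scalar_mxC -mulmxA mulVmx // mulmx1.
have trigT : is_trig_mx (c *: T + d%:M).
  apply/is_trig_mxP => i j lt_ij; rewrite !mxE ((is_trig_mxP tT) i j) // mulr0.
  by rewrite -val_eqE /= (ltn_eqF lt_ij) addr0.
apply: has_spectrum_perm (has_spectrum_trigonal Pu trigT) _.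
rewrite perm_sym (perm_trans (perm_map _ sT)) // -map_comp.
rewrite (@eq_map _ _ _ (fun i => (c *: T + d%:M) i i)) // => i /=.
by rewrite !mxE eqxx.
Qed.

Lemma trace_horner n (M : 'M[C]_n.+1) s p : has_spectrum M s ->
  \tr (horner_mx M p) = \sum_(x <- s) p.[x].
Proof.
move=> /has_spectrum_trig[P [T [Pu -> tT sT]]].
have Vu : invmx P \in unitmx by rewrite unitmx_inv.
have := horner_mx_uconj p T Vu; rewrite !invmxK => ->.
rewrite mxtrace_mulC mulmxA mulmxV // mul1mx (perm_big _ sT) big_map big_enum.
by apply: eq_bigr => i _; rewrite (horner_mx_trig p tT).2.
Qed.

(** A nonzero polynomial has finitely many roots. The coefficients lie in an integral domain because
    they will also be polynomials themselves. *)
Lemma poly_nat_eq0 (R : idomainType) (p : {poly R}) :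
  (forall k l : nat, k%:R = l%:R :> R -> k = l) ->
  (forall k, p.[k.+1%:R] = 0) -> p = 0.
Proof.
move=> inj p0; apply/eqP/negPn/negP => /max_poly_roots.
move=> /(_ [seq k.+1%:R | k <- iota 0 (size p)]).
rewrite size_map size_iota ltnn => H; apply/notF/H.
  by apply/allP => _ /mapP[k _ ->]; rewrite rootE p0.
by rewrite map_inj_uniq ?iota_uniq // => k l /inj [].
Qed.

Lemma nat_inj_num (k l : nat) : k%:R = l%:R :> C -> k = l.
Proof. by move=> /eqP; rewrite eqr_nat => /eqP. Qed.

Lemma nat_inj_poly (k l : nat) : k%:R = l%:R :> {poly C} -> k = l.
Proof. by rewrite -!polyC_natr => /polyC_inj/nat_inj_num. Qed.

(** The outer variable ['X] is the parameter of the pencil; the inner one, embedded as ['X%:P], is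
    the variable of the characteristic polynomial. *)
Definition pencil_char_poly n (A B : 'M[C]_n) : {poly {poly C}} :=
  \det (('X%:P)%:M - map_mx (fun x => x%:P%:P) A
        - 'X *: map_mx (fun x => x%:P%:P) B).

Lemma pencil_char_polyE n (A B : 'M[C]_n) c :
  (pencil_char_poly A B).[c%:P] = char_poly (A + c *: B).
Proof.
rewrite /pencil_char_poly -horner_evalE -det_map_mx /char_poly.
congr (\det _); apply/matrixP => i j.
rewrite !mxE /= horner_evalE !hornerE polyCD polyCM opprD addrA.
congr (_ - _ - _).
by case: (i == j); rewrite ?mulr1n ?mulr0n ?hornerE.
Qed.

(** A pair [(a, b)] encodes the line [c |-> a + c b] of eigenvalues. *)
Definition lines_poly (s : seq (C * C)) : {poly {poly C}} :=
  \prod_(p <- s) ('X%:P - p.1%:P%:P - p.2%:P *: 'X).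

Lemma lines_polyE s c :
  (lines_poly s).[c%:P] = \prod_(p <- s) ('X - (p.1 + c * p.2)%:P).
Proof.
rewrite /lines_poly horner_prod; apply: eq_bigr => p _.
by rewrite !hornerE mulrC polyCD polyCM opprD addrA.
Qed.

Lemma has_spectrum_lines n (A B : 'M[C]_n) s :
  pencil_char_poly A B = lines_poly s ->
  forall c, has_spectrum (A + c *: B) [seq p.1 + c * p.2 | p <- s].
Proof.
by move=> e c; rewrite /has_spectrum -pencil_char_polyE e lines_polyE big_map.
Qed.

(** Both characteristic polynomials are polynomial in the parameter and agree at all positive
    integers. *)
Lemma has_spectrum_pencil n (A B : 'M[C]_n) s :
  (forall k : nat, has_spectrum (A + k.+1%:R *: B)
                     [seq p.1 + k.+1%:R * p.2 | p <- s]) ->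
  forall c, has_spectrum (A + c *: B) [seq p.1 + c * p.2 | p <- s].
Proof.
move=> sk; apply: has_spectrum_lines; apply/eqP; rewrite -subr_eq0; apply/eqP.
apply: poly_nat_eq0 nat_inj_poly _ => k; rewrite -polyC_natr hornerD hornerN.
by rewrite pencil_char_polyE lines_polyE sk big_map subrr.
Qed.

End Spectrum.

(** * First-order variation of traces along a pencil *)

Section TraceDerivative.
Variable C : numClosedFieldType.

Lemma deriv_mulmx m n p (U : 'M[{poly C}]_(m, n)) (V : 'M_(n, p)) :
  map_mx (@deriv C) (U *m V) =
  map_mx (@deriv C) U *m V + U *m map_mx (@deriv C) V.
Proof.
apply/matrixP => i j; rewrite !mxE raddf_sum -big_split /=.
by apply: eq_bigr => k _; rewrite !mxE derivM.
Qed.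

Variables (n : nat) (A B : 'M[C]_n.+1).
Let Bp : 'M[{poly C}]_n.+1 := map_mx polyC B.
Let W : 'M[{poly C}]_n.+1 := map_mx polyC A + 'X *: Bp.

(** Leibniz rule and cyclicity of the trace; the extra factor [W ^+ j] makes the induction on [k] go
    through. At [k = 0] both sides vanish, whatever [k.-1] is. *)
Lemma trace_deriv_pencil_exp j k :
  \tr (W ^+ j *m map_mx (@deriv C) (W ^+ k)) = \tr (W ^+ (j + k.-1) *m Bp) *+ k.
Proof.
have dW : map_mx (@deriv C) W = Bp.
  apply/matrixP => a b; rewrite !mxE derivD derivC derivM derivX derivC.
  by rewrite mul1r mulr0 addr0 add0r.
elim: k j => [|k IHk] j.
  rewrite expr0 mulr0n (_ : map_mx _ _ = 0) ?mulmx0 ?mxtrace0 //.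
  by apply/matrixP => a b; rewrite !mxE; case: (a == b); rewrite ?derivC.
rewrite exprS -mulmxE deriv_mulmx dW mulmxDr mxtraceD mulrS; congr (_ + _).
  by rewrite mulmxA mxtrace_mulC mulmxA mulmxE -exprD addnC.
rewrite mulmxA (_ : W ^+ j *m W = W ^+ j.+1); last by rewrite exprSr.
rewrite IHk.
by case: k {IHk} => [|k]; rewrite ?mulr0n //= addSnnS.
Qed.

(** As polynomials in the parameter, [tr (W ^ k)] is the sum of the [(p.1 + p.2 X) ^ k].
    Differentiating at 0 with exponent [k + 1] and dividing by [k + 1] settles [h = X ^ k]; the rest
    is linearity. *)
Lemma trace_horner_pencil s (h : {poly C}) :
  (forall c, has_spectrum (A + c *: B) [seq p.1 + c * p.2 | p <- s]) ->
  \tr (horner_mx A h *m B) = \sum_(p <- s) h.[p.1] * p.2.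
Proof.
move=> sp; have evW c : map_mx (horner_eval c) W = A + c *: B.
  by apply/matrixP => a b; rewrite !mxE /= horner_evalE !hornerE mulrC.
have trW k : \tr (W ^+ k) = \sum_(p <- s) (p.1%:P + p.2 *: 'X) ^+ k.
  apply/eqP; rewrite -subr_eq0; apply/eqP.
  apply: poly_nat_eq0 (@nat_inj_num C) _ => m; set c := m.+1%:R.
  rewrite hornerD hornerN -[(\tr _).[_]]horner_evalE -trace_map_mx.
  rewrite rmorphXn /= evW horner_sum.
  have := trace_horner 'X^k (sp c); rewrite rmorphXn /= horner_mx_X => ->.
  rewrite big_map; apply/eqP; rewrite subr_eq0; apply/eqP.
  by apply: eq_bigr => p _; rewrite !hornerE mulrC.
have trX k : \tr (A ^+ k *m B) = \sum_(p <- s) p.1 ^+ k * p.2.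
  have := trace_deriv_pencil_exp 0 k.+1; rewrite expr0 mul1mx /= add0n.
  have -> : \tr (map_mx (@deriv C) (W ^+ k.+1)) = (\tr (W ^+ k.+1))^`().
    by rewrite raddf_sum; apply: eq_bigr => i _; rewrite mxE.
  rewrite trW => /(congr1 (horner_eval 0)) /=.
  rewrite !horner_evalE hornerMn -[(\tr _).[_]]horner_evalE -trace_map_mx.
  rewrite map_mxM /=.
  rewrite rmorphXn /= evW scale0r addr0 (_ : map_mx _ Bp = B); last first.
    by apply/matrixP => a b; rewrite !mxE /= horner_evalE hornerC.
  rewrite (_ : _.[0] = k.+1%:R * \sum_(p <- s) p.1 ^+ k * p.2).
    rewrite -[RHS]mulr_natl => /esym/mulfI; apply; by rewrite pnatr_eq0.
  rewrite linear_sum horner_sum mulr_sumr; apply: eq_bigr => p _ /=.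
  rewrite deriv_exp derivD derivC add0r derivZ derivX hornerMn !hornerE.
  by rewrite /= -mulrA mulr_natl [p.2 * _]mulrC.
have hE : h = \sum_(i < size h) h`_i *: 'X^i by rewrite -poly_def coefK.
rewrite {1}hE raddf_sum mulmx_suml (raddf_sum (@mxtrace C n.+1)).
under [RHS]eq_bigr => p _ do rewrite horner_coef mulr_suml.
rewrite [RHS]exchange_big /=; apply: eq_bigr => i _ /=.
rewrite linearZ -scalemxAl mxtraceZ rmorphXn /= horner_mx_X trX mulr_sumr.
by apply: eq_bigr => p _; rewrite mulrA.
Qed.
End TraceDerivative.

(** * Eigenvalues of integral pencils stay near finitely many lines *)

Section NearLines.
Variable C : numClosedFieldType.

Lemma has_spectrum_scale n (M : 'M[C]_n) s c : has_spectrum M s ->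
  has_spectrum (c *: M) [seq c * x | x <- s].
Proof.
move=> /(has_spectrum_affine c 0); rewrite raddf0 addr0.
by under eq_map => x do rewrite addr0.
Qed.

Lemma has_spectrum_homogeneous n (A B : 'M[C]_n) s :
  (forall c, has_spectrum (A + c *: B) [seq p.1 + c * p.2 | p <- s]) ->
  forall u v, has_spectrum (u *: A + v *: B) [seq u * p.1 + v * p.2 | p <- s].
Proof.
move=> sp; have nz u v : u != 0 ->
    has_spectrum (u *: A + v *: B) [seq u * p.1 + v * p.2 | p <- s].
  move=> nzu; have := has_spectrum_scale u (sp (v / u)).
  rewrite scalerDr scalerA mulrCA divff // mulr1 -map_comp.
  rewrite (@eq_map _ _ _ (fun p => u * p.1 + v * p.2)) // => p /=.
  by field.
move=> u v; have [->|] := eqVneq u 0; last exact: nz.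
(* Scaling cannot reach [u = 0]. The pencil [B + c A] is known at the positive integers [c], hence
   also at [c = 0]. *)
have spB c : has_spectrum (B + c *: A) [seq p.2 + c * p.1 | p <- s].
  have := @has_spectrum_pencil _ _ B A [seq (p.2, p.1) | p <- s] _ c.
  rewrite -map_comp; apply => k; rewrite -map_comp.
  have := nz k.+1%:R 1; rewrite pnatr_eq0 scale1r addrC => /(_ isT).
  by rewrite (@eq_map _ _ _ (fun p => p.2 + k.+1%:R * p.1)) // => p /=; ring.
have := has_spectrum_scale v (spB 0).
rewrite !scale0r addr0 add0r -map_comp.
by rewrite (@eq_map _ _ _ (fun p => 0 * p.1 + v * p.2)) // => p /=; ring.
Qed.

Lemma prod_lower_bound (T : eqType) (f : T -> int) (c : int) (r : seq T) :
  0 <= c -> (forall x, x \in r -> c <= f x) ->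
  c ^+ size r <= \prod_(x <- r) f x.
Proof.
move=> c_ge0; elim: r => [|x r IHr] le_cf; first by rewrite big_nil.
rewrite big_cons /= exprS ler_pM ?exprn_ge0 ?le_cf ?mem_head //.
by apply: IHr => y ry; rewrite le_cf // inE ry orbT.
Qed.

(** The points [k a] are at least [k] apart, so all but at most one are at distance at least [k / 2]
    from [l]. Their factors contribute at least [k ^ 2 / 4] each, which leaves a bound independent
    of [k] for the square of the remaining distance. *)
Lemma close_multiple (d : seq int) (k : nat) (K : nat) (l : int) :
  d != [::] -> uniq d -> (0 < k)%N ->
  \prod_(a <- d) (l - k%:Z * a) ^+ 2 * k%:Z ^+ 2
    <= K%:Z * (k%:Z ^+ 2) ^+ size d ->
  exists2 a, a \in d & `|l - k%:Z * a| <= (4 ^ size d * K)%N%:Z.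
Proof.
move=> nz_d d_uniq k_gt0 bd.
have [a0 d_a0 far] : exists2 a0, a0 \in d &
    forall a, a \in d -> a != a0 -> k%:Z <= 2 * `|l - k%:Z * a|.
  have [/hasP[a0 d_a0 near]|/hasPn far] :=
    boolP (has (fun a => 2 * `|l - k%:Z * a| < k%:Z) d).
    exists a0 => // a _ ne_a.
    have : k%:Z <= `|(l - k%:Z * a0) - (l - k%:Z * a)|.
      rewrite (_ : _ - _ = k%:Z * (a - a0)); last by ring.
      rewrite normrM -[leLHS]mulr1 ler_pM //.
      by rewrite -gtz0_ge1 normr_gt0 subr_eq0.
    by have := ler_normB (l - k%:Z * a0) (l - k%:Z * a); lia.
  case: d nz_d far {d_uniq bd} => // a0 d _ far.
  exists a0; rewrite ?mem_head //.
  by move=> a d_a _; rewrite leNgt far.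
exists a0 => //.
have := perm_to_rem d_a0; set r := rem a0 d => d_r.
have farr : (k%:Z ^+ 2) ^+ size r <= \prod_(a <- r) (4 * (l - k%:Z * a) ^+ 2).
  apply: prod_lower_bound => [|a]; first exact: exprn_ge0.
  rewrite mem_rem_uniq // inE => /andP[ne_a d_a].
  rewrite -[(_ - _) ^+ 2]real_normK ?num_real // (_ : 4 = 2 ^+ 2) // -exprMn.
  by rewrite lerXn2r ?nnegrE ?mulr_ge0 // far.
rewrite (perm_big _ d_r) big_cons (perm_size d_r) /= in bd *.
rewrite big_split /= big_const_seq count_predT iter_mulr_1 in farr.
set P := \prod_(_ <- _) _ in farr bd; set x := l - _ in bd *.
have k2_gt0 : 0 < k%:Z ^+ 2 by rewrite exprn_gt0.
have x2 : x ^+ 2 <= (4 ^ size r * K)%N%:Z.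
  rewrite -(ler_pM2r (exprn_gt0 (size r) k2_gt0)).
  apply: le_trans (ler_wpM2l (sqr_ge0 x) farr) _.
  have -> : (4 ^ size r * K)%N%:Z = 4 ^+ size r * K%:Z :> int.
    by rewrite PoszM -(natz (4 ^ _)) natrX.
  rewrite mulrCA -[leRHS]mulrA ler_wpM2l ?exprn_ge0 //.
  by rewrite -(ler_pM2r k2_gt0) (le_trans bd) // exprS mulrA mulrAC.
(* An integer is bounded in absolute value by its square. *)
have x1 : `|x| <= x ^+ 2.
  by have [->|nzx] := eqVneq x 0; rewrite // -real_normK ?num_real //; nia.
apply: le_trans x1 (le_trans x2 _); rewrite lez_nat leq_mul2r.
by rewrite leq_exp2l ?leqnSn ?orbT.
Qed.

Lemma trace_horner_poly n (A B : 'M[C]_n.+1) (P : {poly C}) :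
  exists q : {poly C}, forall c, q.[c] = \tr (horner_mx (A + c *: B) P).
Proof.
pose W : 'M[{poly C}]_n.+1 := map_mx polyC A + 'X *: map_mx polyC B.
exists (\sum_(i < size P) P`_i *: \tr (W ^+ i)) => c.
have evW : map_mx (horner_eval c) W = A + c *: B.
  by apply/matrixP => a b; rewrite !mxE /= horner_evalE !hornerE mulrC.
have PE : P = \sum_(i < size P) P`_i *: 'X^i by rewrite -poly_def coefK.
rewrite [in RHS]PE raddf_sum (raddf_sum (@mxtrace C n.+1)) horner_sum.
apply: eq_bigr => i _ /=; rewrite linearZ mxtraceZ hornerZ; congr (_ * _).
by rewrite -horner_evalE -trace_map_mx rmorphXn /= evW rmorphXn /= horner_mx_X.
Qed.

Hypothesis archi : forall x : C, exists m : nat, `|x| <= m%:R.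

(** The constant term is 0, the linear terms cancel, and a term of degree at least 2 contributes at
    most twice its coefficient times the square of [1 / (k + 1)], which is at most 1. *)
Lemma even_part_bound (q : {poly C}) : q.[0] = 0 ->
  exists K : nat, forall k : nat,
    `|q.[k.+1%:R^-1] + q.[- k.+1%:R^-1]| <= K%:R * k.+1%:R^-1 ^+ 2.
Proof.
move=> q0; have [K leK] := archi (\sum_(i < size q) `|q`_i| * 2).
exists K => k; set t := k.+1%:R^-1.
have t_ge0 : 0 <= t by rewrite invr_ge0 ler0n.
have t_le1 : t <= 1 by rewrite invf_le1 ?ltr0n // ler1n.
apply: le_trans (ler_wpM2r (exprn_ge0 2 t_ge0)
  (le_trans (real_ler_norm _) leK)); last first.
  by apply: sum_real => i _; rewrite realM ?normr_real // realn.
rewrite !horner_coef -big_split mulr_suml /= (le_trans (ler_norm_sum _ _ _)) //.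
apply: ler_sum => -[[|[|i]] /= _] _.
- by rewrite -horner_coef0 q0 !(mul0r, addr0, normr0).
- by rewrite !expr1 mulrN subrr normr0 !mulr_ge0 ?exprn_ge0.
rewrite -mulrDr normrM -mulrA ler_wpM2l // (le_trans (ler_normD _ _)) //.
rewrite !normrX normrN ger0_norm // -mulr2n mulr_natl lerMn2r /=.
by rewrite -addn2 addnC exprD ler_piMr ?exprn_ge0 ?exprn_ile1.
Qed.

Definition int_spectrum n (M : 'M[C]_n) :=
  forall x, eigenvalue M x -> exists z : int, x = z%:~R.

Lemma int_spectrum_exists n (M : 'M[C]_n) : int_spectrum M ->
  exists s : seq int, has_spectrum M [seq z%:~R | z <- s].
Proof.
move=> intM; have [s Ms] := has_spectrum_exists M.
suff [zs szs] : exists zs : seq int, s = [seq z%:~R | z <- zs].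
  by exists zs; rewrite -szs.
have {intM Ms} : forall x, x \in s -> exists z : int, x = z%:~R.
  by move=> x sx; apply: intM; rewrite (eigenvalue_spectrum _ Ms).
elim: s => [|x s IHs] int_s; first by exists [::].
have [z ->] := int_s x (mem_head _ _).
have [|zs ->] := IHs; last by exists (z :: zs).
by move=> y sy; apply: int_s; rewrite inE sy orbT.
Qed.

(* The trace of [prod_a (Z + t Y - a)^2] over the distinct eigenvalues [a] of
   [Z] is polynomial in [t] and vanishes at [0]; adding its values at [1/k] and
   [-1/k] also removes the linear term, and as both are sums of squares of
   rational numbers each square is [O(1/k^2)]. *)
Lemma eigenvalues_near_lines n (Z Y : 'M[C]_n.+1) :
  int_spectrum Z ->
  (forall k : nat, int_spectrum (k.+1%:R *: Z + Y)) ->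
  (forall k : nat, int_spectrum (k.+1%:R *: Z - Y)) ->
  exists (d : seq int) (K : nat), forall k l,
    eigenvalue (k.+1%:R *: Z + Y) l ->
    exists2 a, a \in d & exists2 m : int, `|m| <= K%:Z &
      l = m%:~R + k.+1%:R * a%:~R.
Proof.
move=> /int_spectrum_exists[zs Zzs] intp intm.
pose d := undup zs; pose P : {poly C} := \prod_(a <- d) ('X - a%:~R%:P) ^+ 2.
have PE x : P.[x] = \prod_(a <- d) (x - a%:~R) ^+ 2.
  by rewrite horner_prod; apply: eq_bigr => a _; rewrite !hornerE.
have [q qE] := trace_horner_poly Z Y P.
have q0 : q.[0] = 0.
  rewrite qE scale0r addr0 (trace_horner P Zzs) big_map.
  rewrite big1_seq // => z /= zs_z.
  by rewrite PE (big_rem z) ?mem_undup //= subrr expr0n mul0r.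
have [K leK] := even_part_bound q0.
(* Multiplication by [(k + 1) ^ (2 |d|)] clears the denominators: the trace becomes an integer sum
   of squares. It is used for [e = 1] and [e = -1]. *)
have sumE k (s : seq int) (e : C) : e ^+ 2 = 1 ->
    has_spectrum (k.+1%:R *: Z + e *: Y) [seq z%:~R | z <- s] ->
    q.[e * k.+1%:R^-1] * (k.+1%:R ^+ 2) ^+ size d =
      (\sum_(z <- s) \prod_(a <- d) (z - k.+1%:Z * a) ^+ 2)%:~R.
  move=> e2 sp; have nzk : k.+1%:R != 0 :> C by rewrite pnatr_eq0.
  have := has_spectrum_scale k.+1%:R^-1 sp.
  rewrite scalerDr !scalerA mulVf // scale1r mulrC => sp'.
  rewrite qE (trace_horner P sp') -map_comp big_map mulr_suml raddf_sum /=.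
  apply: eq_bigr => z _; rewrite PE rmorph_prod /=.
  elim: (d) => [|a r IHr]; first by rewrite !big_nil expr0 mulr1.
  rewrite !big_cons /= [_ ^+ (size r).+1]exprS mulrACA IHr; congr (_ * _).
  rewrite -exprMn rmorphXn rmorphB rmorphM /=; congr (_ ^+ 2).
  by rewrite mulrBl mulrAC mulVf // mul1r mulrC.
exists d, (4 ^ size d * K)%N => k l.
have [sp Hsp] := int_spectrum_exists (intp k).
have [sm Hsm] := int_spectrum_exists (intm k).
rewrite (eigenvalue_spectrum _ Hsp) => /mapP[z sp_z ->].
pose f z := \prod_(a <- d) (z - k.+1%:Z * a) ^+ 2.
have f_ge0 y : 0 <= f y by apply: prodr_ge0 => a _; apply: sqr_ge0.
have sum_le : (\sum_(y <- sp) f y + \sum_(y <- sm) f y) * k.+1%:Z ^+ 2 <=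
    K%:Z * (k.+1%:Z ^+ 2) ^+ size d.
  set S := _ + _; have S_ge0 : 0 <= S by rewrite addr_ge0 ?sumr_ge0.
  have hp := sumE k sp 1 (expr1n _ _); rewrite scale1r mul1r in hp.
  have hm := sumE k sm (-1) (etrans (sqrrN 1) (expr1n _ _)).
  rewrite scaleN1r mulN1r in hm.
  have := congr2 +%R (hp Hsp) (hm Hsm); rewrite -mulrDl -rmorphD /= -/S => SE.
  have e_ge0 : 0 <= (k.+1%:R ^+ 2) ^+ size d :> C by rewrite !exprn_ge0.
  rewrite -(ler_int C) (rmorphM _ S) (rmorphM _ K%:Z) /=.
  rewrite -[S%:~R]ger0_norm ?ler0z // -SE normrM.
  rewrite (ger0_norm e_ge0) !rmorphXn /= mulrAC.
  rewrite ler_wpM2r // -(ler_pM2r (_ : 0 < k.+1%:R^-1 ^+ 2 :> C)); last first.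
    by rewrite exprn_gt0 // invr_gt0 ltr0n.
  by rewrite -mulrA -exprMn divff ?pnatr_eq0 // expr1n mulr1 leK.
have nz_d : d != [::].
  rewrite -size_eq0 -lt0n /d -has_predT.
  have := size_spectrum Zzs; rewrite size_map.
  by case: (zs) => // y r _; apply/hasP; exists y; rewrite ?mem_undup ?mem_head.
have [|a d_a near] := @close_multiple d k.+1 K z nz_d (undup_uniq _) (ltn0Sn _).
  apply: le_trans sum_le; rewrite ler_wpM2r ?exprn_ge0 // (big_rem z sp_z) /=.
  by rewrite -[leRHS]addrA lerDl addr_ge0 ?sumr_ge0.
exists a => //; exists (z - k.+1%:Z * a) => //.
by rewrite rmorphB rmorphM /= subrK.
Qed.

End NearLines.

(** * Enumeration of finitely many candidate spectra *)

Fixpoint words (T : Type) (L : seq T) (n : nat) : seq (seq T) :=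
  if n is m.+1 then [seq x :: w | x <- L, w <- words L m] else [:: [::]].

Lemma mem_words (T : eqType) (L : seq T) (w : seq T) :
  {subset w <= L} -> w \in words L (size w).
Proof.
elim: w => [|x w IHw] sub; first by rewrite inE.
apply: allpairs_f; first by rewrite sub ?mem_head.
by apply: IHw => y wy; rewrite sub // inE wy orbT.
Qed.

Lemma map_lift (T U : eqType) (f : T -> U) (L : seq T) (s : seq U) :
  (forall y, y \in s -> exists2 x, x \in L & y = f x) ->
  exists2 t, {subset t <= L} & s = map f t.
Proof.
elim: s => [|y s IHs] lift; first by exists [::].
have [x Lx ->] := lift y (mem_head _ _).
have [|t sub ->] := IHs; first by move=> z sz; apply: lift; rewrite inE sz orbT.
by exists (x :: t) => // z; rewrite inE => /predU1P[-> //|/sub].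
Qed.

Lemma mem_int_range (K : nat) (m : int) :
  `|m| <= K%:Z -> m \in [seq i%:Z - K%:Z | i <- iota 0 (K + K).+1].
Proof.
by move=> le_mK; apply/mapP; exists (absz (m + K%:Z)); rewrite ?mem_iota; lia.
Qed.

(** * Factorization of integral pencils into lines *)

Section IntegralPencil.
Variable C : numClosedFieldType.
Hypothesis archi : forall x : C, exists m : nat, `|x| <= m%:R.

(* Each [k Z + Y], [Z = X + Y], has its spectrum on finitely many lines, so
   finitely many candidate factorizations cover all [k]; as a product of
   nonzero polynomials cannot vanish at all [k], one candidate is valid
   identically. *)
Lemma integral_pencil n (X Y : 'M[C]_n.+1) :
  (forall u v : nat, (0 < u + v)%N -> int_spectrum (u%:R *: X + v%:R *: Y)) ->
  exists s : seq (C * C), forall u v,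
    has_spectrum (u *: X + v *: Y) [seq u * p.1 + v * p.2 | p <- s].
Proof.
(* With this [Z], both [(k+1) Z + Y = (k+1) X + (k+2) Y] and [(k+1) Z - Y = (k+1) X + k Y] have
   natural coefficients. *)
move=> intXY; pose Z := X + Y.
have intZ : int_spectrum Z by have := intXY 1 1 isT; rewrite !scale1r.
have intp k : int_spectrum (k.+1%:R *: Z + Y).
  have := intXY k.+1 k.+2 isT.
  by rewrite [k.+2%:R]mulrSr scalerDl scale1r addrA -scalerDr.
have intm k : int_spectrum (k.+1%:R *: Z - Y).
  have := intXY k.+1 k; rewrite addSn => /(_ isT).
  rewrite /Z scalerDr -addrA [k.+1%:R *: Y](_ : _ = k%:R *: Y + Y) ?addrK //.
  by rewrite mulrSr scalerDl scale1r.
have [d [K near]] := eigenvalues_near_lines archi intZ intp intm.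
pose L : seq (C * C) := [seq (m%:~R, a%:~R) |
  m <- [seq i%:Z - K%:Z | i <- iota 0 (K + K).+1], a <- d].
pose F := pencil_char_poly Y Z.
have : \prod_(w <- words L n.+1) (lines_poly w - F) = 0.
  apply: poly_nat_eq0 (@nat_inj_poly C) _ => k.
  have [t Ht] := has_spectrum_exists (k.+1%:R *: Z + Y).
  have [l|w wL tw] := @map_lift _ _ (fun p => p.1 + k.+1%:R * p.2) L t.
    rewrite -(eigenvalue_spectrum _ Ht) => /near[a d_a [m le_mK ->]].
    exists (m%:~R, a%:~R) => //.
    apply: (allpairs_f (fun m a => (m%:~R, a%:~R) : C * C)) => //.
    exact: mem_int_range.
  have Lw : w \in words L n.+1.
    have <- : size w = n.+1 by rewrite -(size_spectrum Ht) tw size_map.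
    exact: mem_words.
  rewrite (big_rem w Lw) /= hornerM (_ : _.[_] = 0) ?mul0r //.
  rewrite -polyC_natr hornerD hornerN lines_polyE /F pencil_char_polyE.
  by rewrite [Y + _]addrC Ht tw big_map subrr.
move/eqP; rewrite prodf_seq_eq0 => /hasP[w _ /=].
rewrite subr_eq0 => /eqP/esym/has_spectrum_lines/has_spectrum_homogeneous sw.
(* Change of variables [u X + v Y = (v - u) Y + u Z]. *)
exists [seq (p.2 - p.1, p.1) | p <- w] => u v; rewrite -map_comp.
have := sw (v - u) u; rewrite (_ : _ *: Y + _ = u *: X + v *: Y); last first.
  by rewrite scalerDr [LHS]addrCA scalerBl subrK.
rewrite (@eq_map _ _ _ (fun p => u * (p.2 - p.1) + v * p.1)) // => p /=.
by ring.
Qed.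

End IntegralPencil.

(** * Maxima of bounded functions and counting of distinct values *)

Lemma bounded_nat_max (J : Type) (c : J -> nat) (b : nat) (j0 : J) :
  (forall j, (c j <= b)%N) -> exists i, forall j, (c j <= c i)%N.
Proof.
move: {2}(b - c j0)%N (erefl (b - c j0)%N) => m.
elim/ltn_ind: m j0 => m IHm j0 em le_cb.
case: (classic (exists j, (c j0 < c j)%N)) => [[j lt_j]|nex].
  by apply: (IHm (b - c j)%N _ j) => //; have := le_cb j; lia.
exists j0 => j; rewrite leqNgt; apply/negP => lt_j; apply: nex.
by exists j.
Qed.

Lemma uniq_map_inj (T U : eqType) (f : T -> U) (s : seq T) :
  uniq (map f s) -> {in s &, injective f}.
Proof.
elim: s => [|a s IHs] //= /andP[nfa us] x y; rewrite !inE.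
move=> /predU1P[->|sx] /predU1P[->|sy] // fxy; last exact: IHs.
  by case/negP: nfa; rewrite fxy map_f.
by case/negP: nfa; rewrite -fxy map_f.
Qed.

(** The images of the distinct entries of [s] cover the values of [f]; if there are at least as many
    values as entries, no two of these images coincide. *)
Lemma size_undup_map_inj (T U : eqType) (f : T -> U) (s : seq T) :
  (size (undup s) <= size (undup (map f s)))%N -> {in s &, injective f}.
Proof.
move=> le_s; have sub : {subset undup (map f s) <= map f (undup s)}.
  move=> y; rewrite mem_undup => /mapP[x sx ->].
  by rewrite map_f ?mem_undup.
have um : uniq (map f (undup s)).
  by rewrite (leq_size_uniq (undup_uniq _) sub) // size_map.
by move=> x y sx sy; apply: (uniq_map_inj um); rewrite mem_undup.
Qed.

(** * From factored pencils to linear forms *)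

Section Family.
Variable C : numClosedFieldType.

Lemma nat_avoid (bad : seq C) : exists u : nat, u.+1%:R \notin bad.
Proof.
apply: NNPP => all_bad.
have /eqP : \prod_(b <- bad) ('X - b%:P) = 0.
  apply: poly_nat_eq0 (@nat_inj_num C) _ => k; apply/rootP.
  rewrite root_prod_XsubC; apply/negPn/negP => nb; apply: all_bad.
  by exists k.
by apply/negP/monic_neq0/monic_prod_XsubC.
Qed.

Definition lagrange_poly (r : seq C) (a : C) : {poly C} :=
  let g : {poly C} := \prod_(x <- [seq x <- r | x != a]) ('X - x%:P) in
  g.[a]^-1 *: g.

Lemma lagrange_polyE r a x : x \in r -> (lagrange_poly r a).[x] = (x == a)%:R.
Proof.
move=> rx; rewrite /lagrange_poly; set r' := filter _ _.
have rootg y : root (\prod_(z <- r') ('X - z%:P)) y = (y \in r').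
  exact: root_prod_XsubC.
set g := \prod_(_ <- _) _ in rootg *; rewrite hornerZ.
have nz : g.[a] != 0 by have := rootg a; rewrite mem_filter eqxx /root => ->.
have [->|ne_xa] := eqVneq x a; first by rewrite mulVf.
have := rootg x; rewrite mem_filter ne_xa rx => /eqP ->.
by rewrite mulr0.
Qed.

(** Eigenvalues are given by trace forms common to all [j]; these are linear on the whole matrix
    space, so they extend beyond the family. *)
Definition linear_spectra (J : Type) n (M : J -> 'M[C]_n) :=
  exists hs : seq 'M[C]_n,
    forall j, has_spectrum (M j) [seq \tr (H *m M j) | H <- hs].

Variables (J : Type) (op : J -> J -> J).

Lemma additive_mul n (M : J -> 'M[C]_n) :
  (forall i j, M (op i j) = M i + M j) ->
  forall k j, exists i, M i = k.+1%:R *: M j.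
Proof.
move=> Mop k j; elim: k => [|k [i Mi]]; first by exists j; rewrite scale1r.
by exists (op j i); rewrite Mop Mi [in RHS]mulrS scalerDl scale1r.
Qed.

(* Pick [A] in the family with as many distinct eigenvalues as possible. Along
   the pencil of [A] and any [B] the eigenvalues then never split further, so
   the slope [b] of the line through the eigenvalue [a] of [A] is a function of
   [a], equal to [tr (h_a(A) B)] over the multiplicity of [a], where [h_a] is
   the Lagrange polynomial of [a]. *)
Lemma linear_spectra_of_pencils n (M : J -> 'M[C]_n.+1) :
  (forall i j, M (op i j) = M i + M j) ->
  (forall i j, exists s : seq (C * C), forall u v,
     has_spectrum (u *: M i + v *: M j) [seq u * p.1 + v * p.2 | p <- s]) ->
  linear_spectra M.
Proof.
move=> Mop pencil; case: (classic (inhabited J)) => [[j0]|noJ]; last first.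
  by exists [::] => j; case: noJ.
pose sp j := sval (has_spectrum_exists (M j)).
have spP j : has_spectrum (M j) (sp j).
  by rewrite /sp; case: has_spectrum_exists.
have [i0 maxi] : exists i, forall j,
    (size (undup (sp j)) <= size (undup (sp i)))%N.
  apply: (@bounded_nat_max _ (fun j => size (undup (sp j))) n.+1 j0) => j.
  by rewrite (leq_trans (size_undup _)) // (size_spectrum (spP j)).
set A := M i0 in maxi *; set r := sp i0 in maxi.
pose H a := (count_mem a r)%:R^-1 *: horner_mx A (lagrange_poly r a).
exists (map H r) => j; set B := M j; have [s sAB] := pencil i0 j.
have spA : perm_eq r (map fst s).
  apply: (has_spectrum_uniq (spP i0)).
  have := sAB 1 0; rewrite scale1r scale0r addr0.
  by rewrite (@eq_map _ _ _ fst) // => p; rewrite mul1r mul0r addr0.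
have spB : has_spectrum B (map snd s).
  have := sAB 0 1; rewrite scale1r scale0r add0r.
  by rewrite (@eq_map _ _ _ snd) // => p; rewrite mul1r mul0r add0r.
have inj1 : {in s &, injective fst}.
  (* [u + 1] avoids the finitely many values at which two pairs with distinct first coordinates give
     the same [g], so [g] is injective on [s]. *)
  have [u avoid] := nat_avoid [seq (q.2 - p.2) / (p.1 - q.1) | p <- s, q <- s].
  pose g p := u.+1%:R * p.1 + p.2 : C.
  have inj_g : {in s &, injective g}.
    move=> p q s_p s_q /eqP; rewrite /g -subr_eq0 => /eqP gpq.
    have e1 : p.1 = q.1.
      apply/eqP; rewrite -subr_eq0; apply: contraNT avoid => nz.
      apply/allpairsP; exists (p, q); split=> //=.
      apply: (mulIf nz); rewrite divfK //; apply/eqP.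
      by rewrite -subr_eq0 -gpq; apply/eqP; ring.
    rewrite [p]surjective_pairing [q]surjective_pairing e1; congr pair.
    by apply/eqP; rewrite -subr_eq0 -gpq e1; apply/eqP; ring.
  (* The member [(u + 1) A + B] of the family has as many distinct eigenvalues as [s] has distinct
     pairs; by maximality of [A], so does [A] at least. *)
  apply: size_undup_map_inj.
  have [i Mi] := additive_mul Mop u i0.
  have spg : has_spectrum (M (op i j)) (map g s).
    have := sAB u.+1%:R 1; rewrite scale1r Mop Mi.
    by rewrite (@eq_map _ _ _ g) // => p; rewrite mul1r.
  have := maxi (op i j).
  rewrite (perm_size (perm_undup (perm_mem (has_spectrum_uniq (spP _) spg)))).
  rewrite (perm_size (perm_undup (perm_mem spA))); apply: leq_trans.
  rewrite -(size_map g); apply: uniq_leq_size.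
    rewrite map_inj_in_uniq ?undup_uniq // => p q.
    by rewrite !mem_undup; apply: inj_g.
  by move=> _ /mapP[p s_p ->]; rewrite mem_undup map_f // -mem_undup.
apply: (has_spectrum_perm spB); rewrite perm_sym -map_comp.
apply: (perm_trans (perm_map _ spA)); rewrite -map_comp.
rewrite (_ : map _ s = map snd s) //; apply/eq_in_map => p s_p /=.
have rE q : q \in s -> q.1 \in r by move=> s_q; rewrite (perm_mem spA) map_f.
rewrite /H -scalemxAl mxtraceZ (@trace_horner_pencil _ _ A B s); last first.
  move=> c; have := sAB 1 c; rewrite scale1r.
  by rewrite (@eq_map _ _ _ (fun p => p.1 + c * p.2)) // => q; rewrite mul1r.
rewrite (eq_big_seq (fun q => (q.1 == p.1)%:R * p.2)) => [|q s_q]; last first.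
  rewrite lagrange_polyE ?rE //; have [e1|_] := eqVneq q.1 p.1.
    by rewrite (inj1 q p).
  by rewrite !mul0r.
rewrite -mulr_suml -natr_sum (_ : (\sum_(q <- s) _)%N = count_mem p.1 r).
  by rewrite mulKf // pnatr_eq0 -lt0n -has_count has_pred1 rE.
rewrite (permP spA) count_map -sum1_count [RHS]big_mkcond /=.
by apply: eq_bigr => q _; case: eqP.
Qed.

End Family.

(** * Common eigenvectors, Sylvester's equation and block decompositions *)

Section ExpFamily.
Variable C : numClosedFieldType.

(** [A] and [B] stabilize the eigenspace of [D], and their commuting restrictions have a common
    eigenvector. *)
Lemma common_eigenvector_in n (A B D : 'M[C]_n) g :
  comm_mx A B -> comm_mx D A -> comm_mx D B -> eigenvalue D g ->
  exists (y : 'rV_n) (a b : C),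
    [/\ y != 0, y *m A = a *: y, y *m B = b *: y & y *m D = g *: y].
Proof.
move=> cAB cDA cDB Dg; set V := eigenspace D g.
have sA : stablemx V A by apply: comm_mx_stable_eigenspace.
have sB : stablemx V B by apply: comm_mx_stable_eigenspace.
have [||v nzv /andP[vA vB]] :=
  @common_eigenvector2 _ _ (restrictmx V A) (restrictmx V B).
- by rewrite lt0n mxrank_eq0.
- by rewrite -!conjmxM ?inE ?stablemx_row_base // cAB.
rewrite !stablemx_restrict // in vA vB; set y := v *m row_base V in vA vB.
move/eigenvectorP: vA => [a ya]; move/eigenvectorP: vB => [b yb].
exists y, a, b; split; first by rewrite mulmx_free_eq0 ?row_base_free.
- exact/eigenspaceP.
- exact/eigenspaceP.
by apply/eigenspaceP; rewrite mulmx_sub // eq_row_base.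
Qed.

(* Sylvester's equation: [kermx X] is stable under the invertible
   [A1 - l], so an eigenvector [u X] of [A2] for [l] must vanish. *)
Lemma sylvester_eq0 m n (A1 : 'M[C]_m) (A2 : 'M[C]_n) (X : 'M_(m, n)) :
  A1 *m X = X *m A2 ->
  (forall l, eigenvalue A1 l -> eigenvalue A2 l -> False) -> X = 0.
Proof.
move=> eqX disj; apply/eqP/negPn/negP => nzX.
pose W := <<X>>%MS; have sX : stablemx W A2.
  by rewrite genmxE (eqmxMr _ (genmxE _)) -eqX submxMl.
have [|v nzv /andP[vA _]] :=
  @common_eigenvector2 _ _ (restrictmx W A2) _ _ erefl.
  by rewrite lt0n genmxE mxrank_eq0.
rewrite stablemx_restrict // in vA; set y := v *m row_base W in vA.
have nzy : y != 0 by rewrite mulmx_free_eq0 ?row_base_free.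
move/eigenvectorP: vA => [l /eigenspaceP yl].
have [u yE] : exists u, y = u *m X.
  by apply/submxP; rewrite mulmx_sub // eq_row_base genmxE.
have A2l : eigenvalue A2 l by apply/eigenvalueP; exists y.
have unitN : A1 - l%:M \in unitmx.
  rewrite -row_free_unit -kermx_eq0; apply/negPn/negP => nzK.
  by apply: (disj l).
have cX : (A1 - l%:M) *m X = X *m (A2 - l%:M).
  by rewrite mulmxBl mulmxBr eqX scalar_mxC.
have kN : (kermx X *m (A1 - l%:M) <= kermx X)%MS.
  by apply/sub_kermxP; rewrite -mulmxA cX mulmxA mulmx_ker mul0mx.
have kE : (kermx X <= kermx X *m (A1 - l%:M))%MS.
  by rewrite -(mxrank_leqif_sup kN).2 mxrankMfree ?row_free_unit.
have : (u *m (A1 - l%:M) <= kermx X)%MS.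
  apply/sub_kermxP; rewrite -mulmxA cX mulmxA -yE mulmxBr yl.
  by rewrite mul_mx_scalar subrr.
move=> /submx_trans/(_ kE); rewrite submxMfree ?row_free_unit //.
by move=> /sub_kermxP uX; rewrite yE uX eqxx in nzy.
Qed.

Lemma eigenvector_horner n (A : 'M[C]_n.+1) (y : 'rV_n.+1) l p :
  y *m A = l *: y -> y *m horner_mx A p = p.[l] *: y.
Proof.
move=> yA; elim/poly_ind: p => [|p c IHp].
  by rewrite rmorph0 mulmx0 horner0 scale0r.
rewrite rmorphD rmorphM /= horner_mx_X horner_mx_C mulmxDr mulmxA IHp.
by rewrite -scalemxAl yA mul_mx_scalar !hornerE scalerDl scalerA.
Qed.

(** The rows of [B1] and [B2] are bases of two complementary subspaces, and [Q1], [Q2] give the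
    coordinates in them; [B1 *m G *m Q1] is then a diagonal block of [G], and [B1 *m G *m Q2] an
    off-diagonal one. *)
Record splitting n n1 n2 (B1 : 'M[C]_(n1, n)) (B2 : 'M[C]_(n2, n))
    (Q1 : 'M[C]_(n, n1)) (Q2 : 'M[C]_(n, n2)) : Prop := Splitting {
  split11 : B1 *m Q1 = 1%:M; split12 : B1 *m Q2 = 0;
  split21 : B2 *m Q1 = 0; split22 : B2 *m Q2 = 1%:M;
  splitD : Q1 *m B1 + Q2 *m B2 = 1%:M }.

Lemma splittingC n n1 n2 (B1 : 'M[C]_(n1, n)) (B2 : 'M[C]_(n2, n)) Q1 Q2 :
  splitting B1 B2 Q1 Q2 -> splitting B2 B1 Q2 Q1.
Proof. by case=> *; split; rewrite // addrC. Qed.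

Lemma splitting_inverse n n1 n2
    (B1 : 'M[C]_(n1, n)) (B2 : 'M[C]_(n2, n)) Q1 Q2 :
  splitting B1 B2 Q1 Q2 ->
  col_mx B1 B2 *m row_mx Q1 Q2 = 1%:M /\ row_mx Q1 Q2 *m col_mx B1 B2 = 1%:M.
Proof.
case=> e11 e12 e21 e22 eD.
by rewrite mul_col_row mul_row_col e11 e12 e21 e22 eD scalar_mx_block.
Qed.

Lemma splitting_dim n n1 n2 (B1 : 'M[C]_(n1, n)) (B2 : 'M[C]_(n2, n)) Q1 Q2 :
  splitting B1 B2 Q1 Q2 -> (n1 + n2)%N = n.
Proof. by case/splitting_inverse; apply: mulmx1_dim. Qed.

(** A zero off-diagonal block means that the row space of [B1] is stable under [G]. *)
Lemma splitting_block n n1 n2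
    (B1 : 'M[C]_(n1, n)) (B2 : 'M[C]_(n2, n)) Q1 Q2 G :
  splitting B1 B2 Q1 Q2 -> B1 *m G *m Q2 = 0 -> B1 *m G = B1 *m G *m Q1 *m B1.
Proof.
move=> sp z12; rewrite -[LHS]mulmx1 -(splitD sp) mulmxDr !mulmxA z12.
by rewrite mul0mx addr0.
Qed.

(** The predicate [p] cuts the characteristic polynomial into two coprime factors. By
    Cayley-Hamilton the kernels of these factors at [G] are complementary; [B1] and [B2] are bases
    of them. *)
Lemma eigenvalue_splitting n (G : 'M[C]_n.+1) (p : pred C) :
  exists n1 n2 (B1 : 'M[C]_(n1, n.+1)) (B2 : 'M[C]_(n2, n.+1)) Q1 Q2,
  [/\ splitting B1 B2 Q1 Q2, B1 *m G *m Q2 = 0, B2 *m G *m Q1 = 0,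
      forall l, eigenvalue (B1 *m G *m Q1) l -> p l &
      forall l, eigenvalue (B2 *m G *m Q2) l -> ~~ p l].
Proof.
have [s Gs] := has_spectrum_exists G.
pose P (a : pred C) : {poly C} := \prod_(x <- [seq x <- s | a x]) ('X - x%:P).
pose a' := predC p.
have cop : coprimep (P p) (P a').
  rewrite /P (big_morph _ (@coprimepMl _ _) (coprime1p _)) /= big_all.
  apply/allP => x; rewrite mem_filter => /andP[px _] /=.
  rewrite coprimep_sym coprimep_XsubC.
  have := root_prod_XsubC [seq x <- s | a' x] x; rewrite mem_filter /= px.
  by move=> ->.
have kerT : (kermxpoly G (P p) + kermxpoly G (P a') :=: 1%:M)%MS.
  apply: eqmx_trans (eqmx_sym (kermxpolyM _ cop)) _.
  apply: kermxpoly_min; apply: dvdp_trans (mxminpoly_dvd_char _) _.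
  rewrite Gs -(perm_big _ (permEl (perm_filterC p s))) big_cat.
  exact: dvdpp.
set V1 := kermxpoly G (P p) in kerT; set V2 := kermxpoly G (P a') in kerT.
pose B1 := row_base V1; pose B2 := row_base V2.
have dir : (V1 :&: V2 = 0)%MS by apply: mxdirect_kermxpoly.
pose R := col_mx B1 B2.
have eR : (R :=: 1%:M)%MS.
  apply: eqmx_trans (eqmx_sym (addsmxE _ _)) _.
  by apply: eqmx_trans (adds_eqmx (eq_row_base _) (eq_row_base _)) kerT.
have freeR : row_free R.
  rewrite /row_free eR; apply/eqP.
  by have := mxrank_disjoint_sum dir; rewrite kerT.
pose Q := pinvmx R.
have RQ : R *m Q = 1%:M by apply: mulmxVp.
have QR : Q *m R = 1%:M by rewrite -[Q]mul1mx mulmxKpV // eR.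
rewrite -[Q]hsubmxK in RQ QR.
set Q1 := lsubmx Q in RQ QR; set Q2 := rsubmx Q in RQ QR.
exists _, _, B1, B2, Q1, Q2.
have sp : splitting B1 B2 Q1 Q2.
  move: RQ; rewrite mul_col_row scalar_mx_block.
  move=> /eq_block_mx[e11 e12 e21 e22].
  by move: QR; rewrite mul_row_col => eD; split.
have st (a : pred C) : let V := kermxpoly G (P a) in
    (row_base V *m G <= row_base V)%MS.
  rewrite /= eq_row_base (eqmxMr _ (eq_row_base _)).
  exact/comm_mx_stable_kermxpoly/comm_mx_refl.
have z12 : B1 *m G *m Q2 = 0.
  by have /submxP[D ->] := st p; rewrite -mulmxA (split12 sp) mulmx0.
have z21 : B2 *m G *m Q1 = 0.
  by have /submxP[D ->] := st a'; rewrite -mulmxA (split21 sp) mulmx0.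
have eig (a : pred C) m (B : 'M_(m, n.+1)) (Q' : 'M_(n.+1, m)) l :
    (B <= kermxpoly G (P a))%MS -> B *m Q' = 1%:M ->
    B *m G = B *m G *m Q' *m B -> eigenvalue (B *m G *m Q') l -> a l.
  move=> BV BQ BG /eigenvalueP[x xl nzx].
  have yl : (x *m B) *m G = l *: (x *m B).
    by rewrite -mulmxA BG mulmxA xl -scalemxAl.
  have := eigenvector_horner (P a) yl.
  have -> : x *m B *m horner_mx G (P a) = 0.
    by apply/sub_kermxP; rewrite mulmx_sub.
  move/esym/eqP; rewrite scaler_eq0 => /orP[|/eqP y0]; last first.
    by case/eqP: nzx; rewrite -[x]mulmx1 -BQ mulmxA y0 mul0mx.
  have := root_prod_XsubC [seq x <- s | a x] l; rewrite /root => ->.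
  by rewrite mem_filter => /andP[].
split=> // l; [apply: (eig p)|apply: (eig a')].
- by rewrite eq_row_base.
- exact: split11 sp.
- exact: splitting_block sp z12.
- by rewrite eq_row_base.
- exact: split22 sp.
- exact: splitting_block (splittingC sp) z21.
Qed.

(** * Abstract exponential families and their blocks *)

Variables (J : Type) (op : J -> J -> J) (ex : C -> C).

(** These properties of matrices and their exponentials pass to diagonal blocks, so the induction on
    the size can run on them without mentioning convergence. *)
Record exp_family n (M E : J -> 'M[C]_n) : Prop := ExpFamily {
  famD : forall i j, M (op i j) = M i + M j;
  famM : forall i j, E (op i j) = E i *m E j;
  famC : forall i j, comm_mx (E i) (E j);
  fam_comm : forall i, comm_mx (E i) (M i);
  fam_eigen : forall i (v : 'rV_n) l,
    v *m M i = l *: v -> v *m E i = ex l *: v }.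

(** The index [t] is chosen before [n], [M] and [E], so that one index serves the whole matrices and
    the blocks of all sizes. *)
Lemma op_iterate k j : exists t, forall n,
  (forall M : J -> 'M[C]_n, (forall i j, M (op i j) = M i + M j) ->
     M t = k.+1%:R *: M j) /\
  (forall E : J -> 'M[C]_n, (forall i j, E (op i j) = E i *m E j) ->
     forall (y : 'rV_n) b, y *m E j = b *: y -> y *m E t = b ^+ k.+1 *: y).
Proof.
elim: k => [|k [t tP]].
  by exists j => n; split=> [M _|E _ y b //]; rewrite scale1r.
exists (op t j) => n; have [tM tE] := tP n; split=> [M Mop|E Eop y b yb].
  by rewrite Mop tM // [in RHS]mulrSr scalerDl scale1r.
by rewrite Eop mulmxA (tE E Eop y b yb) -scalemxAl yb scalerA -exprSr.
Qed.

Lemma op_combination p q i j : (0 < p + q)%N -> exists t, forall n,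
  (forall M : J -> 'M[C]_n, (forall i j, M (op i j) = M i + M j) ->
     M t = p%:R *: M i + q%:R *: M j) /\
  (forall E : J -> 'M[C]_n, (forall i j, E (op i j) = E i *m E j) ->
     forall (y : 'rV_n) a b, y *m E i = a *: y -> y *m E j = b *: y ->
     y *m E t = (a ^+ p * b ^+ q) *: y).
Proof.
case: p q => [|p] [|q] // _.
- have [t tP] := op_iterate q j; exists t => n; have [tM tE] := tP n.
  split=> [M Mop|E Eop y a b ya yb]; first by rewrite tM // scale0r add0r.
  by rewrite (tE _ _ _ b) // expr0 mul1r.
- have [t tP] := op_iterate p i; exists t => n; have [tM tE] := tP n.
  split=> [M Mop|E Eop y a b ya yb].
    by rewrite tM // scale0r addr0.
  by rewrite (tE _ _ _ a) // mulr1.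
have [s sP] := op_iterate p i; have [t tP] := op_iterate q j.
exists (op s t) => n; have [sM sE] := sP n; have [tM tE] := tP n.
split=> [M Mop|E Eop y a b ya yb]; first by rewrite Mop sM // tM.
rewrite Eop mulmxA (sE E Eop _ a) // -scalemxAl (tE E Eop _ b) //.
by rewrite scalerA.
Qed.

Lemma eigenvalue_combination n (E : J -> 'M[C]_n) i j t (f : C -> C -> C) g :
  (forall i j, comm_mx (E i) (E j)) ->
  (forall (y : 'rV_n) a b, y *m E i = a *: y -> y *m E j = b *: y ->
     y *m E t = f a b *: y) ->
  eigenvalue (E t) g ->
  exists a b, [/\ eigenvalue (E i) a, eigenvalue (E j) b & g = f a b].
Proof.
move=> cE tE /(common_eigenvector_in (cE i j) (cE t i) (cE t j)).
move=> [y [a [b [nzy ya yb yg]]]]; exists a, b; split.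
- by apply/eigenvalueP; exists y.
- by apply/eigenvalueP; exists y.
have := tE y a b ya yb; rewrite yg => /eqP; rewrite -subr_eq0 -scalerBl.
by rewrite scaler_eq0 (negPf nzy) orbF subr_eq0 => /eqP.
Qed.

(** [M i] commutes with [E i], hence has an eigenvector inside the eigenspace of [E i] for [a]. *)
Lemma eigenvalue_fam_exp n (M E : J -> 'M[C]_n) i a :
  exp_family M E -> eigenvalue (E i) a ->
  exists2 l, eigenvalue (M i) l & a = ex l.
Proof.
move=> F.
move=> /(common_eigenvector_in (fam_comm F i) (comm_mx_refl _) (fam_comm F i)).
move=> [y [_ [l [nzy _ yl ya]]]].
exists l; first by apply/eigenvalueP; exists y.
have := fam_eigen F yl; rewrite ya => /eqP; rewrite -subr_eq0 -scalerBl.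
by rewrite scaler_eq0 (negPf nzy) orbF subr_eq0 => /eqP.
Qed.

Lemma char_poly_splitting n n1 n2 (B1 : 'M[C]_(n1, n))
    (B2 : 'M[C]_(n2, n)) Q1 Q2 (G : 'M[C]_n) :
  splitting B1 B2 Q1 Q2 -> B1 *m G *m Q2 = 0 -> B2 *m G *m Q1 = 0 ->
  char_poly G = char_poly (B1 *m G *m Q1) * char_poly (B2 *m G *m Q2).
Proof.
move=> /splitting_inverse[PQ QP] z12 z21.
rewrite -(char_poly_similar G PQ QP) mul_col_mx mul_col_row.
by rewrite z12 z21 /char_poly char_block_diag_mx det_ublock.
Qed.

(** By cyclicity [tr (H (B M Q)) = tr ((Q H B) M)], so a trace form on a block is a trace form on
    the whole matrix. *)
Lemma linear_spectra_splitting n n1 n2 (B1 : 'M[C]_(n1, n))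
    (B2 : 'M[C]_(n2, n)) Q1 Q2 (M : J -> 'M[C]_n) :
  splitting B1 B2 Q1 Q2 ->
  (forall j, B1 *m M j *m Q2 = 0) -> (forall j, B2 *m M j *m Q1 = 0) ->
  linear_spectra (fun j => B1 *m M j *m Q1) ->
  linear_spectra (fun j => B2 *m M j *m Q2) -> linear_spectra M.
Proof.
move=> sp z12 z21 [hs1 H1] [hs2 H2].
exists ([seq Q1 *m H *m B1 | H <- hs1] ++ [seq Q2 *m H *m B2 | H <- hs2]) => j.
rewrite /has_spectrum (char_poly_splitting sp (z12 j) (z21 j)) H1 H2.
rewrite map_cat big_cat /= !big_map.
have trE k (Q : 'M_(n, k)) H (B : 'M_(k, n)) :
    \tr (H *m (B *m M j *m Q)) = \tr (Q *m H *m B *m M j).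
  by rewrite mulmxA mxtrace_mulC !mulmxA.
by congr (_ * _); apply: eq_bigr => H _; rewrite trE.
Qed.

Lemma eigenvalue_block n n1 n2 (B1 : 'M[C]_(n1, n)) (B2 : 'M[C]_(n2, n)) Q1 Q2
    (G : 'M[C]_n) l :
  splitting B1 B2 Q1 Q2 -> B1 *m G *m Q2 = 0 ->
  eigenvalue (B1 *m G *m Q1) l -> eigenvalue G l.
Proof.
move=> sp z12 /eigenvalueP[x xl nzx]; apply/eigenvalueP; exists (x *m B1).
  by rewrite -mulmxA (splitting_block sp z12) mulmxA xl -scalemxAl.
apply: contraNneq nzx => y0.
by rewrite -[x]mulmx1 -(split11 sp) mulmxA y0 mul0mx.
Qed.

(** The off-diagonal block of [H] solves Sylvester's equation for the two diagonal blocks of [G]. *)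
Lemma commuting_block_eq0 n n1 n2
    (B1 : 'M[C]_(n1, n)) (B2 : 'M[C]_(n2, n)) Q1 Q2
    (G H : 'M[C]_n) :
  splitting B1 B2 Q1 Q2 -> B1 *m G *m Q2 = 0 -> comm_mx G H ->
  (forall l, eigenvalue (B1 *m G *m Q1) l -> eigenvalue (B2 *m G *m Q2) l ->
     False) ->
  B1 *m H *m Q2 = 0.
Proof.
move=> sp z12 cGH; apply: sylvester_eq0.
rewrite !mulmxA -(splitting_block sp z12) -[B1 *m G *m H]mulmxA cGH mulmxA.
rewrite -3!mulmxA -[in LHS](mul1mx (G *m Q2)) -(splitD sp) mulmxDl -!mulmxA.
by rewrite [B1 *m (G *m Q2)]mulmxA z12 mulmx0 add0r !mulmxA.
Qed.

Lemma mulmx_block n n1 n2 (B1 : 'M[C]_(n1, n)) (B2 : 'M[C]_(n2, n)) Q1 Q2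
    (U V : 'M[C]_n) :
  splitting B1 B2 Q1 Q2 -> B1 *m U *m Q2 = 0 ->
  B1 *m U *m Q1 *m (B1 *m V *m Q1) = B1 *m (U *m V) *m Q1.
Proof. by move=> sp zU; rewrite !mulmxA -(splitting_block sp zU). Qed.

Lemma exp_family_block n n1 n2 (B1 : 'M[C]_(n1, n)) (B2 : 'M[C]_(n2, n)) Q1 Q2
    (M E : J -> 'M[C]_n) :
  splitting B1 B2 Q1 Q2 ->
  (forall j, B1 *m M j *m Q2 = 0) -> (forall j, B1 *m E j *m Q2 = 0) ->
  exp_family M E ->
  exp_family (fun j => B1 *m M j *m Q1) (fun j => B1 *m E j *m Q1).
Proof.
move=> sp zM zE F.
split=> [i j|i j|i j|i|i v l vl].
- by rewrite (famD F) mulmxDr mulmxDl.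
- by rewrite (famM F) (mulmx_block _ sp).
- by rewrite /comm_mx !(mulmx_block _ sp) // (famC F).
- by rewrite /comm_mx !(mulmx_block _ sp) // (fam_comm F).
have yl : (v *m B1) *m M i = l *: (v *m B1).
  by rewrite -mulmxA (splitting_block sp (zM i)) mulmxA vl -scalemxAl.
rewrite !mulmxA (fam_eigen F yl) -scalemxAl -mulmxA (split11 sp).
by rewrite mulmx1.
Qed.

(** [N] is a product, over the finitely many pairs having one, of an exponent at which the powers
    agree. *)
Lemma common_unity_exponent (s : seq C) : exists2 N : nat, (0 < N)%N &
  forall x y k, x \in s -> y \in s -> (0 < k)%N -> x ^+ k = y ^+ k ->
  x ^+ N = y ^+ N.
Proof.
have pairs (L : seq (C * C)) : exists2 N : nat, (0 < N)%N &
    forall p k, p \in L -> (0 < k)%N -> p.1 ^+ k = p.2 ^+ k ->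
    p.1 ^+ N = p.2 ^+ N.
  elim: L => [|p L [N N_gt0 LN]]; first by exists 1%N.
  case: (classic (exists2 k, (0 < k)%N & p.1 ^+ k = p.2 ^+ k)).
    move=> [k k_gt0 pk]; exists (N * k)%N; first by rewrite muln_gt0 N_gt0.
    move=> q m; rewrite inE => /predU1P[-> _ _|Lq m_gt0 qm].
      by rewrite mulnC !exprM pk.
    by rewrite !exprM (LN q m).
  move=> nex; exists N => // q m; rewrite inE => /predU1P[->|] m_gt0 qm.
    by case: nex; exists m.
  exact: LN qm.
have [N N_gt0 sN] := pairs [seq (x, y) | x <- s, y <- s].
exists N => // x y k sx sy; apply: (sN (x, y)).
exact: allpairs_f.
Qed.

Lemma eventually_all (T : eqType) (L : seq T) (P : T -> nat -> Prop) :
  (forall x, x \in L -> exists m, forall k, (m <= k)%N -> P x k) ->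
  exists m, forall k, (m <= k)%N -> forall x, x \in L -> P x k.
Proof.
elim: L => [|x L IHL] ev; first by exists 0%N.
have [m1 P1] := ev x (mem_head _ _).
have [|m2 P2] := IHL; first by move=> y Ly; apply: ev; rewrite inE Ly orbT.
exists (maxn m1 m2) => k; rewrite geq_max => /andP[le1 le2] y.
by rewrite inE => /predU1P[->|]; [apply: P1|apply: P2].
Qed.

(** Equality can hold for at most one exponent: dividing two equalities, at [m < k], would give
    [a ^ (k - m) = a' ^ (k - m)]. *)
Lemma eventually_separated (a a' b b' : C) :
  a != 0 -> b != 0 -> a' != 0 -> b' != 0 ->
  (forall k, (0 < k)%N -> a ^+ k <> a' ^+ k) ->
  exists m, forall k, (m <= k)%N -> a ^+ k * b <> a' ^+ k * b'.
Proof.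
move=> nza nzb nza' nzb' sep.
case: (classic (exists k, a ^+ k * b = a' ^+ k * b')) => [[m em]|nex];
  last first.
  by exists 0%N => k _ e; apply: nex; exists k.
exists m.+1 => k lt_mk ek; apply: (sep (k - m)%N); first by rewrite subn_gt0.
apply: (mulIf (mulf_neq0 (expf_neq0 m nza) nzb)).
rewrite mulrA -exprD subnK 1?ltnW // ek em mulrA -exprD subnK // ltnW //.
Qed.

(** * Simultaneous block decomposition of a family *)

Hypothesis ex_neq0 : forall x, ex x != 0.

Lemma family_blocks_eq0 n n1 n2 (B1 : 'M[C]_(n1, n)) (B2 : 'M[C]_(n2, n)) Q1 Q2
    (M E : J -> 'M[C]_n) j0 :
  splitting B1 B2 Q1 Q2 -> exp_family M E ->
  B1 *m E j0 *m Q2 = 0 -> B2 *m E j0 *m Q1 = 0 ->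
  (forall a b k, eigenvalue (B1 *m E j0 *m Q1) a ->
     eigenvalue (B2 *m E j0 *m Q2) b -> (0 < k)%N -> a ^+ k <> b ^+ k) ->
  forall j, B1 *m E j *m Q2 = 0 /\ B1 *m M j *m Q2 = 0.
Proof.
move=> sp F z12 z21 sep.
have disj0 l : eigenvalue (B1 *m E j0 *m Q1) l ->
    eigenvalue (B2 *m E j0 *m Q2) l -> False.
  by move=> l1 l2; apply: (sep l l 1%N).
have zE j : B1 *m E j *m Q2 = 0.
  exact: (commuting_block_eq0 sp z12 (famC F j0 j)).
have zE' j : B2 *m E j *m Q1 = 0.
  apply: (commuting_block_eq0 (splittingC sp) z21 (famC F j0 j)) => l l2 l1.
  exact: disj0 l l1 l2.
have zM0 : B1 *m M j0 *m Q2 = 0.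
  exact: (commuting_block_eq0 sp z12 (fam_comm F j0)).
pose E1 j := B1 *m E j *m Q1; pose E2 j := B2 *m E j *m Q2.
have E1M i j : E1 (op i j) = E1 i *m E1 j.
  by rewrite /E1 (famM F) (mulmx_block _ sp).
have E2M i j : E2 (op i j) = E2 i *m E2 j.
  by rewrite /E2 (famM F) (mulmx_block _ (splittingC sp)).
have E1C i j : comm_mx (E1 i) (E1 j).
  by rewrite /comm_mx !(mulmx_block _ sp) // (famC F).
have E2C i j : comm_mx (E2 i) (E2 j).
  by rewrite /comm_mx !(mulmx_block _ (splittingC sp)) // (famC F).
have nz1 j a : eigenvalue (E1 j) a -> a != 0.
  by move=> /(eigenvalue_block sp (zE j))/(eigenvalue_fam_exp F)[l _ ->].
have nz2 j a : eigenvalue (E2 j) a -> a != 0.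
  move=> /(eigenvalue_block (splittingC sp) (zE' j)).
  by move=> /(eigenvalue_fam_exp F)[l _ ->].
move=> j; split=> //.
have [s1 S1] := has_spectrum_exists (E1 j0).
have [s2 S2] := has_spectrum_exists (E2 j0).
have [r1 R1] := has_spectrum_exists (E1 j).
have [r2 R2] := has_spectrum_exists (E2 j).
have [|m sepm] := @eventually_all _
  [seq (p, q) | p <- [seq (a, b) | a <- s1, b <- r1],
                q <- [seq (a, b) | a <- s2, b <- r2]]
  (fun pq k => pq.1.1 ^+ k * pq.1.2 <> pq.2.1 ^+ k * pq.2.2).
  move=> pq /allpairsP[[p q] /= [hp hq ->]].
  have /allpairsP[[a b] /= [sa rb ->]] := hp.
  have /allpairsP[[a' b'] /= [sa' rb' ->]] := hq.
  have S1a : eigenvalue (E1 j0) a by rewrite (eigenvalue_spectrum _ S1).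
  have S2a : eigenvalue (E2 j0) a' by rewrite (eigenvalue_spectrum _ S2).
  apply: eventually_separated; first exact: nz1 S1a.
  - by apply: (nz1 j); rewrite (eigenvalue_spectrum _ R1).
  - exact: nz2 S2a.
  - by apply: (nz2 j); rewrite (eigenvalue_spectrum _ R2).
  by move=> k; apply: sep.
(* [t] stands for [m] times [j0] plus [j]. The blocks of [E t] have no common eigenvalue, so the
   off-diagonal block of [m M j0 + M j] vanishes, as that of [M j0] does. *)
have [t tP] := @op_combination m 1 j0 j (leq_addl _ _).
have disjt l : eigenvalue (E1 t) l -> eigenvalue (E2 t) l -> False.
  move=> /(eigenvalue_combination E1C ((tP _).2 _ E1M))[a [b [ea eb lab]]].
  move=> /(eigenvalue_combination E2C ((tP _).2 _ E2M))[a' [b' [ea' eb' lab']]].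
  apply: (sepm m (leqnn m) ((a, b), (a', b'))).
    apply: allpairs_f; apply: allpairs_f.
    - by rewrite -(eigenvalue_spectrum _ S1).
    - by rewrite -(eigenvalue_spectrum _ R1).
    - by rewrite -(eigenvalue_spectrum _ S2).
    - by rewrite -(eigenvalue_spectrum _ R2).
  by move: lab; rewrite lab' !expr1.
have := commuting_block_eq0 sp (zE t) (fam_comm F t) disjt.
rewrite ((tP _).1 _ (famD F)) scale1r mulmxDr mulmxDl -scalemxAr -scalemxAl.
by rewrite zM0 scaler0 add0r.
Qed.

(** * Ratios that are roots of unity, and the induction on the size *)

Hypothesis archi : forall x : C, exists m : nat, `|x| <= m%:R.
Hypothesis exD : forall x y, ex (x + y) = ex x * ex y.
Variable w : C.
Hypothesis w_neq0 : w != 0.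
Hypothesis ex_ker : forall x, ex x = 1 -> exists z : int, x = z%:~R * w.

Lemma ex_0 : ex 0 = 1.
Proof. by apply: (mulfI (ex_neq0 0)); rewrite -exD addr0 mulr1. Qed.

Lemma ex_natmul k x : ex (k%:R * x) = ex x ^+ k.
Proof.
elim: k => [|k IHk]; first by rewrite mul0r ex_0.
by rewrite mulrSr mulrDl mul1r exD IHk exprSr.
Qed.

Lemma pencil_of_unity_ratios n (M E : J -> 'M[C]_n.+1) :
  exp_family M E ->
  (forall j a b, eigenvalue (E j) a -> eigenvalue (E j) b ->
     exists2 k, (0 < k)%N & a ^+ k = b ^+ k) ->
  forall i j, exists s : seq (C * C), forall u v,
    has_spectrum (u *: M i + v *: M j) [seq u * p.1 + v * p.2 | p <- s].
Proof.
move=> F ratio i j.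
have [N N_gt0 sameN] : exists2 N : nat, (0 < N)%N & forall t a b,
    t = i \/ t = j -> eigenvalue (E t) a -> eigenvalue (E t) b ->
    a ^+ N = b ^+ N.
  have [si Si] := has_spectrum_exists (E i).
  have [sj Sj] := has_spectrum_exists (E j).
  have [N1 N1_gt0 P1] := common_unity_exponent si.
  have [N2 N2_gt0 P2] := common_unity_exponent sj.
  exists (N1 * N2)%N => [|t a b ij ta tb]; first by rewrite muln_gt0 N1_gt0.
  have [k k_gt0 ek] := ratio _ _ _ ta tb.
  case: ij ta tb => ->.
    rewrite !(eigenvalue_spectrum _ Si) => sa sb.
    by rewrite !exprM (P1 a b k).
  rewrite !(eigenvalue_spectrum _ Sj) => sa sb.
  by rewrite mulnC !exprM (P2 a b k).
have nzN : N%:R != 0 :> C by rewrite pnatr_eq0 -lt0n.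
have [al ali] := eigenvalue_closed (M i) (ltn0Sn n).
have [be bej] := eigenvalue_closed (M j) (ltn0Sn n).
have exE t l : eigenvalue (M t) l -> eigenvalue (E t) (ex l).
  move=> /eigenvalueP[x xl nzx]; apply/eigenvalueP; exists x => //.
  exact: fam_eigen F _ _ _ xl.
pose X := (N%:R / w) *: (M i - al%:M); pose Y := (N%:R / w) *: (M j - be%:M).
have [u v uv_gt0 x|s sXY] := @integral_pencil _ archi _ X Y.
  move=> /eigenvalueP[y yx nzy].
  have Nuv : (0 < N * u + N * v)%N by rewrite -mulnDr muln_gt0 N_gt0.
  have [t tP] := @op_combination _ _ i j Nuv.
  (* The eigenvalue of [M t = N u M i + N v M j] that corresponds to the eigenvalue [x] of
     [u X + v Y]. *)
  pose l := w * x + (N%:R * (u%:R * al + v%:R * be)).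
  have tl : eigenvalue (M t) l.
    apply/eigenvalueP; exists y => //; rewrite ((tP _).1 _ (famD F)).
    have -> : (N * u)%:R *: M i + (N * v)%:R *: M j =
      w *: (u%:R *: X + v%:R *: Y) + (N%:R * (u%:R * al + v%:R * be))%:M.
      apply/matrixP => r q; rewrite !mxE !natrM.
      by case: (r == q); rewrite ?mulr1n ?mulr0n; field.
    by rewrite mulmxDr -scalemxAr yx mul_mx_scalar scalerA -scalerDl.
  have [a [b [ea eb eab]]] :=
    eigenvalue_combination (famC F) ((tP _).2 _ (famM F)) (exE _ _ tl).
  (* All eigenvalues of [E i] have the same [N]-th power as [ex al], and those of [E j] the same as
     [ex be]. Hence [ex l] is [ex (N (u al + v be))], and [ex (w x) = 1]. *)
  have [|z zE] := ex_ker (x := w * x).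
    apply: (mulIf (ex_neq0 (N%:R * (u%:R * al + v%:R * be)))).
    rewrite -exD -/l eab mul1r ex_natmul exD exprMn !ex_natmul.
    rewrite !exprM (sameN i a (ex al)) ?(sameN j b (ex be)); auto.
    by rewrite -!exprM ![(N * _)%N]mulnC.
  by exists z; apply: (mulIf w_neq0); rewrite mulrC.
pose c := w / N%:R.
exists [seq (c * p.1 + al, c * p.2 + be) | p <- s] => u v.
have := has_spectrum_affine c (u * al + v * be) (sXY u v).
rewrite -!map_comp.
have -> : c *: (u *: X + v *: Y) + (u * al + v * be)%:M = u *: M i + v *: M j.
  apply/matrixP => r q; rewrite !mxE /c.
  by case: (r == q); rewrite ?mulr1n ?mulr0n; field; rewrite w_neq0.
rewrite (@eq_map _ _ _ (fun p => u * (c * p.1 + al) + v * (c * p.2 + be))) //.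
by move=> p /=; ring.
Qed.

Lemma linear_spectra_exp_family n (M E : J -> 'M[C]_n) :
  exp_family M E -> linear_spectra M.
Proof.
elim/ltn_ind: n M E => -[|n] IHn M E F.
  exists [::] => j; rewrite /has_spectrum /char_poly big_nil.
  exact: det_mx00.
case: (classic (exists j a b, [/\ eigenvalue (E j) a, eigenvalue (E j) b &
    forall k, (0 < k)%N -> a ^+ k <> b ^+ k])); last first.
  move=> nex; apply: (linear_spectra_of_pencils (op := op) (famD F)).
  apply: (pencil_of_unity_ratios F) => j a b ja jb; apply: NNPP => nk.
  by apply: nex; exists j, a, b; split=> // k k_gt0 ek; apply: nk; exists k.
move=> [j0 [a [b [ja jb sepab]]]].
have [s S] := has_spectrum_exists (E j0).
(* With this [N], two eigenvalues of [E j0] agree at some positive power exactly when their [N]-th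
   powers agree; the splitting isolates the class of [a]. *)
have [N N_gt0 sN] := common_unity_exponent s.
have [n1 [n2 [B1 [B2 [Q1 [Q2 [sp z12 z21 p1 p2]]]]]]] :=
  eigenvalue_splitting (E j0) [pred x | x ^+ N == a ^+ N].
have sC := splittingC sp.
have sep x y k : eigenvalue (B1 *m E j0 *m Q1) x ->
    eigenvalue (B2 *m E j0 *m Q2) y -> (0 < k)%N -> x ^+ k <> y ^+ k.
  move=> x1 y2 k_gt0 xy; have /= := p2 y y2; rewrite -(eqP (p1 x x1)) => /eqP.
  apply; apply/esym/(sN _ _ _ _ _ k_gt0 xy).
    by rewrite -(eigenvalue_spectrum _ S) (eigenvalue_block sp z12).
  by rewrite -(eigenvalue_spectrum _ S) (eigenvalue_block sC z21).
have sep' x y k : eigenvalue (B2 *m E j0 *m Q2) x ->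
    eigenvalue (B1 *m E j0 *m Q1) y -> (0 < k)%N -> x ^+ k <> y ^+ k.
  by move=> x2 y1 k_gt0 /esym; apply: sep.
have z1 := family_blocks_eq0 sp F z12 z21 sep.
have z2 := family_blocks_eq0 sC F z21 z12 sep'.
have eig0 x : eigenvalue (E j0) x ->
    eigenvalue (B1 *m E j0 *m Q1) x || eigenvalue (B2 *m E j0 *m Q2) x.
  by rewrite !eigenvalue_root_char (char_poly_splitting sp z12 z21) rootM.
have dim_gt0 k (G : 'M[C]_k) x : eigenvalue G x -> (0 < k)%N.
  by case: k G => // G /eigenvalueP[y _]; rewrite thinmx0 eqxx.
(* [a] belongs to the first block and [b] to the second, so both are nonempty and each is smaller
   than the whole. *)
have n1_gt0 : (0 < n1)%N.
  have /orP[/dim_gt0 //|/p2 /=] := eig0 a ja; by rewrite eqxx.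
have n2_gt0 : (0 < n2)%N.
  have /orP[/p1 /= /eqP bN|/dim_gt0 //] := eig0 b jb.
  by case: (sepab N N_gt0).
have dim := splitting_dim sp.
apply: (linear_spectra_splitting sp) => [j|j||].
- by have [] := z1 j.
- by have [] := z2 j.
- apply: IHn; first by rewrite -dim -addn1 leq_add2l.
  by apply: (exp_family_block sp) F => j; have [] := z1 j.
- apply: IHn; first by rewrite -dim -add1n leq_add2r.
  by apply: (exp_family_block sC) F => j; have [] := z2 j.
Qed.

End ExpFamily.

(** * Extension from the family to its linear span *)

Section Span.
Variables (C : numClosedFieldType) (J : Type) (op : J -> J -> J).

(** Induction on the number of terms, in the presence of a leading [M j]: a positive integer
    multiple of [M i] is absorbed into it, and the pencil argument passes from positive integers to
    all scalars. *)
Lemma linear_spectra_span n (M : J -> 'M[C]_n) (hs : seq 'M[C]_n) :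
  (forall i j, M (op i j) = M i + M j) ->
  (forall j, has_spectrum (M j) [seq \tr (H *m M j) | H <- hs]) ->
  J -> forall L : seq (C * J), let X := \sum_(p <- L) p.1 *: M p.2 in
  has_spectrum X [seq \tr (H *m X) | H <- hs].
Proof.
move=> MD spM j0.
have shifted L : forall j, let X := M j + \sum_(p <- L) p.1 *: M p.2 in
    has_spectrum X [seq \tr (H *m X) | H <- hs].
  elim: L => [|[c i] L IHL] j /=; first by rewrite big_nil addr0.
  rewrite big_cons addrCA [_ *: _ + _]addrC /=; set A := M j + _ in IHL *.
  have trE d : [seq \tr (H *m (A + d *: M i)) | H <- hs] =
      [seq p.1 + d * p.2 | p <- [seq (\tr (H *m A), \tr (H *m M i)) | H <- hs]].
    rewrite -map_comp; apply: eq_map => H /=.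
    by rewrite mulmxDr mxtraceD -scalemxAr mxtraceZ.
  rewrite trE; apply: has_spectrum_pencil => k; rewrite -trE.
  have [t tP] := op_iterate C op k i.
  have := IHL (op j t); rewrite MD ((tP n).1 M MD) /=.
  by rewrite addrAC.
(* The leading [M j0] is cancelled by an extra term with coefficient [-1]. *)
move=> L /=; have := shifted ((-1, j0) :: L) j0.
by rewrite /= big_cons scaleN1r addrA subrr add0r.
Qed.

End Span.

(** * Transfer to an algebraically closed numeric field *)

Section Transfer.
Local Notation K := (Rdefinitions.R[i]).

(** A ring isomorphism onto [R[i]], which carries the [numClosedFieldType] structure used above. *)
Definition to_Ri (z : complex) : K := complex.Complex (Re z) (Im z).
Definition of_Ri (z : K) : complex := Cplx (complex.Re z) (complex.Im z).

Lemma to_RiK : cancel to_Ri of_Ri. Proof. by case. Qed.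
Lemma of_RiK : cancel of_Ri to_Ri. Proof. by case. Qed.

Fact to_Ri_is_zmod_morphism : zmod_morphism to_Ri.
Proof. by move=> [a b] [c d]. Qed.

Fact to_Ri_is_monoid_morphism : monoid_morphism to_Ri.
Proof. by split=> [|[a b] [c d]]. Qed.

HB.instance Definition _ :=
  GRing.isZmodMorphism.Build complex K to_Ri to_Ri_is_zmod_morphism.
HB.instance Definition _ :=
  GRing.isMonoidMorphism.Build complex K to_Ri to_Ri_is_monoid_morphism.

Lemma archi_Ri (x : K) : exists m : nat, `|x| <= m%:R.
Proof.
rewrite complex.normc_def; set r := Num.sqrt _.
exists (Num.bound r).
rewrite -(rmorph_nat (complex.real_complex _)) complex.lecR.
by apply/ltW/archi_boundP; exact: sqrtr_ge0.
Qed.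

Lemma exp_semigroup_linear_spectra n (S : 'M[complex]_n -> Prop)
    (M := fun A : {A | S A} => map_mx to_Ri (sval A)) :
  (forall A B, S A -> S B -> S (A + B)) ->
  (forall A B, S A -> S B -> mexp (A + B) = mexp A *m mexp B) ->
  exists (op : {A | S A} -> {A | S A} -> {A | S A}),
    (forall i j, M (op i j) = M i + M j) /\ linear_spectra M.
Proof.
move=> SD Sexp.
pose op (A B : {A | S A}) : {A | S A} :=
  exist S (sval A + sval B) (SD _ _ (svalP A) (svalP B)).
have MD i j : M (op i j) = M i + M j by rewrite /M map_mxD.
exists op; split=> //.
pose ex (x : K) := to_Ri (cexp (of_Ri x)).
apply: (@linear_spectra_exp_family _ _ op ex _ archi_Ri _ (to_Ri two_pi_i) _ _
  _ M (fun A => map_mx to_Ri (mexp (sval A)))).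
- by move=> x; rewrite fmorph_eq0 cexp_neq0.
- move=> x y; rewrite /ex -rmorphM -cexpD; congr (to_Ri (cexp _)).
  by apply: (can_inj to_RiK); rewrite rmorphD /= !of_RiK.
- by rewrite fmorph_eq0 two_pi_i_neq0.
- move=> x; rewrite /ex -(rmorph1 to_Ri) => /(can_inj to_RiK)/cexp_eq1[m xm].
  by exists m; rewrite -[x]of_RiK xm rmorphM /= rmorph_int.
have expD (A B : {A | S A}) :
    mexp (sval A + sval B) = mexp (sval A) *m mexp (sval B).
  exact: Sexp (svalP A) (svalP B).
split=> //.
- by move=> A B; rewrite -map_mxM -expD.
(* The exponentials commute because [A + B = B + A]. *)
- by move=> A B; rewrite /comm_mx -!map_mxM -!expD addrC.
- by move=> A; rewrite /comm_mx -!map_mxM comm_mexp.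
move=> A v l vl; have vE : map_mx to_Ri (map_mx of_Ri v) = v.
  by apply/matrixP => i j; rewrite !mxE of_RiK.
rewrite -vE -map_mxM (@mexp_eigenvector _ _ _ (of_Ri l)) ?map_mxZ //.
apply/matrixP => i j; apply: (can_inj to_RiK).
have := congr1 (fun u : 'rV[K]_n => u i j) vl.
rewrite -{1}vE -map_mxM mxE => ->.
by rewrite !mxE rmorphM /= !of_RiK.
Qed.

End Transfer.

(** * Property L of the span, from the trace forms *)

Theorem mainTheorem11 (n : nat) (S : 'M[complex]_n -> Prop)
  (S_add : forall A B, S A -> S B -> S (A + B))
  (S_exp : forall A B, S A -> S B -> mexp (A + B) = mexp A *m mexp B) :
  property_L (in_span S).
Proof.
have [op [MD [hs spM]]] := exp_semigroup_linear_spectra S_add S_exp.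
set M := fun A : {A | S A} => map_mx to_Ri (sval A) in MD spM.
pose f (k : 'I_n) (X : 'M[complex]_n) :=
  of_Ri (\tr (nth 0 hs k *m map_mx to_Ri X)).
(* If [S] is empty, the length of [hs] is unknown, but the span is zero and the zero forms serve.
   Otherwise [hs] has length [n], and the default of [nth] is never reached. *)
case: (classic (exists A, S A)) => [[A0 SA0]|noS]; last first.
  exists (fun _ _ => 0); split=> [k a A B _ _|X [m [c [A [SA ->]]]]].
    by rewrite mulr0 addr0.
  have -> : \sum_(i < m) c i *: A i = 0.
    by apply: big1 => i _; case: noS; exists (A i).
  under eq_bigr do rewrite subr0.
  rewrite char_poly_trig ?mx0_is_trig //.
  by apply: eq_bigr => i _; rewrite mxE subr0.
have size_hs : size hs = n.
  by have := size_spectrum (spM (exist _ A0 SA0)); rewrite size_map.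
exists f; split=> [k a A B _ _|X [m [c [A [SA ->]]]]].
  apply: (can_inj to_RiK); rewrite /f [RHS]rmorphD [in RHS]rmorphM /= !of_RiK.
  by rewrite map_mxD map_mxZ mulmxDr mxtraceD -scalemxAr mxtraceZ.
set Y := \sum_(i < m) _.
have := linear_spectra_span MD spM (exist _ A0 SA0)
  [seq (to_Ri (c i), exist _ (A i) (SA i)) | i <- enum 'I_m].
rewrite /= big_map big_enum /= (_ : \sum_(i < m) _ = map_mx to_Ri Y);
  last first.
  rewrite raddf_sum; apply: eq_bigr => i _ /=.
  by apply/matrixP => a b; rewrite !mxE rmorphM.
rewrite /has_spectrum -map_char_poly big_map => spX.
apply: (map_poly_inj to_Ri); rewrite spX rmorph_prod /=.
rewrite (big_nth 0) big_mkord size_hs; apply: eq_bigr => k _.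
by rewrite rmorphB /= map_polyX map_polyC /= of_RiK.
Qed.
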